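(* Let $r \in [0,1)$, $\alpha \in (0,1)$, $\beta \in [0,1]$ and $v \in \mathfrak{U}_{\beta,\alpha}$. Then $$\lim_{n\to\infty} \mathcal{P}_r^n(v) = \Big(\int_{[0,1]} v \,\mathrm{d}\lambda\Big)\cdot h_r$$ uniformly on every compact subset of $[0,1]\setminus \Omega_r(\beta)$, and there is a set $E\subset[0,1]$ of Hausdorff dimension $0$ such that the convergence holds pointwise at every $x \in [0,1]\setminus E$. Moreover, if $\beta$ is pre-periodic with respect to $T_r$ with period length strictly greater than one, then at every point $x$ of the finite set $\Omega_r(\beta)$, $$\liminf_{n\to\infty} \mathcal{P}_r^n(v)(x) = \Big(\int v\,\mathrm{d}\lambda\Big) h_r(x) \quad\text{and}\quad \limsup_{n\to\infty}\mathcal{P}_r^n(v)(x) = +\infty;$$ and if $\beta$ is pre-periodic with respect to $T_r$ with period length equal to one, then at the single point $x$ of $\Omega_r(\beta)$ we have $\lim_{n\to\infty}\mathcal{P}_r^n(v)(x) = +\infty$.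
   Context: For $r\in[0,1]$ define $T_r:[0,1]\to[0,1]$ by $T_r(x) = \frac{(2-r)x}{1-rx}$ for $0\le x\le 1/2$ and $T_r(x)=\frac{(2-r)(1-x)}{1-r+rx}$ for $1/2<x\le 1$. Its inverse branches are $f_{r,0}(x) = \frac{x}{2-r+rx}$ and $f_{r,1}(x) = \frac{1+(1-r)(1-x)}{2-r+rx}$. The Perron–Frobenius operator is $\mathcal{P}_r(f) = f_{r,0}'\cdot f\circ f_{r,0} + |f_{r,1}'|\cdot f\circ f_{r,1}$ (i.e. $\mathcal P_r f(x)=\sum_{y\in T_r^{-1}x} f(y)/|T_r'(y)|$), applied to any function with values in $\mathbb{C}$ or $[0,+\infty]$. $\lambda$ is Lebesgue measure. The invariant density is $h_r = 1$ if $r=0$, $h_r(x) = \frac{-r}{\ln(1-r)}\cdot\frac{1}{1-r+rx}$ if $r\in(0,1)$, and $h_1(x)=1/x$. $\mathrm{BV}(0,1)$ is the set of right-continuous $f:[0,1]\to\mathbb{C}$ with finite total variation $V_{[0,1]}(f)$ and finite $\|f\|_\infty=\sup|f|$. For $\alpha\in(0,1)$, $\beta\in[0,1]$, $\mathfrak{U}_{\beta,\alpha}$ is the set of positive functions $v:[0,1]\to[0,+\infty]$ such that (a) $v(x)\to+\infty$ as $x\to\beta$ from either side (within $[0,1]$); (b) $v\cdot\mathbb{1}_K\in\mathrm{BV}(0,1)$ for every compact $K\subset[0,1]\setminus\{\beta\}$; (c) there are a connected relatively open neighbourhood $U$ of $\beta$ in $[0,1]$ and constants $C_1,C_2>0$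 with $C_1|\beta-x|^{-\alpha}\le v(x)\le C_2|\beta-x|^{-\alpha}$ for $x\in U$. (Such $v$ are improper Riemann integrable.) The $\omega$-limit set is $\Omega_r(\beta)=\bigcap_{k\ge0}\overline{\{T_r^\ell(\beta):\ell\ge k\}}$. A point $x$ is pre-periodic w.r.t. $T_r$ if there are $m\in\mathbb{N}$, $n\in\mathbb{N}_0$ with $T_r^{n+k}(x)=T_r^{n+m+k}(x)$ for all $k\ge0$; the minimal such $m$ is its period length.
   Formalization: Condition (b), which read literally (e.g. K a single point) leaves no admissible v, is taken as: v restricted to K is finite, bounded, of bounded variation and right-continuous relative to K; that Ω_r(β) is finite (a single point for period one) is not restated. *)

(* Defs.v *)
From Stdlib Require Import Reals Lra Lia Rtopology List.
Import ListNotations.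
Open Scope R_scope.

Definition T (r x : R) : R :=
  if Rle_dec x (1/2) then (2 - r) * x / (1 - r * x)
  else (2 - r) * (1 - x) / (1 - r + r * x).

Definition f0 (r x : R) : R := x / (2 - r + r * x).
Definition f1 (r x : R) : R := (1 + (1 - r) * (1 - x)) / (2 - r + r * x).

(* |f_{r,0}'(x)| and |f_{r,1}'(x)|; both equal (2-r)/(2-r+rx)^2 (see the
   lemmas f0_deriv / f1_deriv below). *)
Definition w0 (r x : R) : R := (2 - r) / (2 - r + r * x) ^ 2.
Definition w1 (r x : R) : R := (2 - r) / (2 - r + r * x) ^ 2.

Lemma f0_deriv (r x : R) : 0 <= r < 1 -> 0 <= x <= 1 ->
  derivable_pt_lim (f0 r) x (w0 r x).
Proof.
  intros Hr Hx.
  assert (HD : 2 - r + r * x <> 0) by nra.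
  assert (H1 : derivable_pt_lim (fun y => y) x 1) by apply derivable_pt_lim_id.
  assert (H2 : derivable_pt_lim (fun y => 2 - r + r * y) x (0 + r * 1)).
  { apply derivable_pt_lim_plus. apply derivable_pt_lim_const.
    apply derivable_pt_lim_scal. apply derivable_pt_lim_id. }
  pose proof (derivable_pt_lim_div _ _ x _ _ H1 H2 HD) as H.
  unfold div_fct in H. unfold f0, w0.
  replace ((2 - r) / (2 - r + r * x) ^ 2) with
    ((1 * (2 - r + r * x) - (0 + r * 1) * x) / Rsqr (2 - r + r * x))
    by (unfold Rsqr; field; auto).
  exact H.
Qed.

Lemma f1_deriv (r x : R) : 0 <= r < 1 -> 0 <= x <= 1 ->
  derivable_pt_lim (f1 r) x (- w1 r x).
Proof.
  intros Hr Hx.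
  assert (HD : 2 - r + r * x <> 0) by nra.
  assert (H1 : derivable_pt_lim (fun y => 1 + (1 - r) * (1 - y)) x (0 + (1 - r) * (0 - 1))).
  { apply derivable_pt_lim_plus. apply derivable_pt_lim_const.
    apply derivable_pt_lim_scal. apply derivable_pt_lim_minus.
    apply derivable_pt_lim_const. apply derivable_pt_lim_id. }
  assert (H2 : derivable_pt_lim (fun y => 2 - r + r * y) x (0 + r * 1)).
  { apply derivable_pt_lim_plus. apply derivable_pt_lim_const.
    apply derivable_pt_lim_scal. apply derivable_pt_lim_id. }
  pose proof (derivable_pt_lim_div _ _ x _ _ H1 H2 HD) as H.
  unfold div_fct in H. unfold f1, w1.
  replace (- ((2 - r) / (2 - r + r * x) ^ 2)) with
    (((0 + (1 - r) * (0 - 1)) * (2 - r + r * x) - (0 + r * 1) * (1 + (1 - r) * (1 - x)))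
       / Rsqr (2 - r + r * x)) by (unfold Rsqr; field; auto).
  exact H.
Qed.

Definition h (r x : R) : R :=
  if Req_EM_T r 0 then 1 else (- r / ln (1 - r)) * (1 / (1 - r + r * x)).

Inductive ER : Type := Fin : R -> ER | PInf : ER.

Definition eadd (a b : ER) : ER :=
  match a, b with Fin x, Fin y => Fin (x + y) | _, _ => PInf end.

(* scaling by a real c >= 0, with the convention 0 * (+oo) = 0 *)
Definition escale (c : R) (a : ER) : ER :=
  match a with
  | Fin y => Fin (c * y)
  | PInf => if Req_EM_T c 0 then Fin 0 else PInf
  end.

Definition enonneg (a : ER) : Prop := match a with Fin y => 0 <= y | PInf => True end.
Definition ege (a : ER) (M : R) : Prop := match a with Fin y => M <= y | PInf => True end.
Definition egt (a : ER) (M : R) : Prop := match a with Fin y => M < y | PInf => True end.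
Definition elt (a : ER) (M : R) : Prop := match a with Fin y => y < M | PInf => False end.
Definition ele (a : ER) (M : R) : Prop := match a with Fin y => y <= M | PInf => False end.
Definition eclose (a : ER) (b eps : R) : Prop :=
  match a with Fin y => Rabs (y - b) < eps | PInf => False end.
(* real part (only used where the value is finite) *)
Definition ereal (a : ER) : R := match a with Fin y => y | PInf => 0 end.

Definition PF (r : R) (f : R -> ER) (x : R) : ER :=
  eadd (escale (w0 r x) (f (f0 r x))) (escale (w1 r x) (f (f1 r x))).

Fixpoint PFn (r : R) (n : nat) (f : R -> ER) : R -> ER :=
  match n with O => f | S m => PF r (PFn r m f) end.

Fixpoint strictly_increasing (l : list R) : Prop :=
  match l with
  | x :: ((y :: _) as t) => x < y /\ strictly_increasing t
  | _ => True
  end.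

Fixpoint variation (f : R -> R) (l : list R) : R :=
  match l with
  | x :: ((y :: _) as t) => Rabs (f y - f x) + variation f t
  | _ => 0
  end.

Definition bv_away (beta : R) (v : R -> ER) : Prop :=
  forall K : R -> Prop, compact K ->
    (forall x, K x -> 0 <= x <= 1 /\ x <> beta) ->
    (forall x, K x -> exists y, v x = Fin y) /\
    (exists M, forall x, K x -> Rabs (ereal (v x)) <= M) /\
    (exists V, forall l : list R, strictly_increasing l -> Forall K l ->
        variation (fun x => ereal (v x)) l <= V) /\
    (forall x, K x -> forall eps, eps > 0 -> exists d, d > 0 /\
        forall y, K y -> x <= y < x + d -> Rabs (ereal (v y) - ereal (v x)) < eps).

Definition in_U (beta alpha : R) (v : R -> ER) : Prop :=
  (forall x, 0 <= x <= 1 -> enonneg (v x)) /\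
  (forall M, exists d, d > 0 /\
     forall x, 0 <= x <= 1 -> 0 < Rabs (x - beta) < d -> ege (v x) M) /\
  bv_away beta v /\
  (* (c) two-sided bound C1|beta-x|^-alpha <= v <= C2|beta-x|^-alpha on a
     relatively open connected neighbourhood of beta in [0,1]; such a
     neighbourhood contains [0,1] /\ (beta-d, beta+d) for some d>0 and at x =
     beta the lower bound reads v(beta) = +oo. *)
  (exists d C1 C2, d > 0 /\ C1 > 0 /\ C2 > 0 /\ v beta = PInf /\
     forall x, 0 <= x <= 1 -> 0 < Rabs (x - beta) < d ->
       ege (v x) (C1 * Rpower (Rabs (beta - x)) (- alpha)) /\
       ele (v x) (C2 * Rpower (Rabs (beta - x)) (- alpha))).

Definition improper_integral (v : R -> ER) (beta I : R) : Prop :=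
  forall eta, eta > 0 -> exists d, d > 0 /\ forall eps, 0 < eps < d ->
    exists (pr1 : Riemann_integrable (fun x => ereal (v x)) 0 (Rmax 0 (beta - eps)))
           (pr2 : Riemann_integrable (fun x => ereal (v x)) (Rmin 1 (beta + eps)) 1),
      Rabs (RiemannInt pr1 + RiemannInt pr2 - I) < eta.

Definition omega_limit (r beta : R) (x : R) : Prop :=
  forall k : nat,
    adherence (fun y => exists l : nat, (k <= l)%nat /\ y = Nat.iter l (T r) beta) x.

Definition preperiodic_m (r beta : R) (m : nat) : Prop :=
  (1 <= m)%nat /\ exists n : nat, forall k : nat,
    Nat.iter (n + k) (T r) beta = Nat.iter (n + m + k) (T r) beta.

Definition period_length (r beta : R) (p : nat) : Prop :=
  preperiodic_m r beta p /\ forall m, preperiodic_m r beta m -> (p <= m)%nat.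

Definition hausdorff_null (s : R) (E : R -> Prop) : Prop :=
  forall eps delta, eps > 0 -> delta > 0 ->
    exists a b : nat -> R,
      (forall i, 0 < b i - a i < delta) /\
      (forall x, E x -> exists i, a i <= x <= b i) /\
      (forall n, sum_f_R0 (fun i => Rpower (b i - a i) s) n <= eps).

Definition hausdorff_dim (E : R -> Prop) (d : R) : Prop :=
  (forall s, 0 <= s -> hausdorff_null s E -> d <= s) /\
  (forall t, (forall s, 0 <= s -> hausdorff_null s E -> t <= s) -> t <= d).

(* Main.v *)
Require Import Defs.
From Stdlib Require Import Reals Rtopology Lra Lia List.
From Stdlib Require Import Classical ClassicalEpsilon.
From Coquelicot Require Import Coquelicot.
Open Scope R_scope.

(** Every inverse branch of [T_r^n] is a Moebius map whose derivative has the
    form [k / (1 + t x)^2] with [k <= (2-r)^(-n)] and [0 <= t <= r / (1 - r)].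

    For a function of bounded variation, [P^n f] is within [O((2-r)^(-n))] of a
    mixture of the densities [(1+t) / (1+tx)^2].  The operator [P] acts on these
    densities as a Markov chain on the parameter [t] which multiplies Lipschitz
    constants by at most [1/(2-r)], so [P^n f] converges uniformly to a multiple
    of a single function, which must be [h_r].

    For the pole, follow the inverse branches along the orbit of [beta]:
    [P^n |. - beta|^(-a) (x) <= C (1 + th^n |x - T^n beta|^(-a))] with [th < 1].
    Taking [a] strictly between [alpha] and [1] makes the contribution of a
    [d]-neighbourhood of [beta] to [P^n v (x)] a small multiple of this bound.
    Hence convergence can fail only at points lying in infinitely many of the
    balls of radius [rho^n] around [T^n beta], a set of dimension [0]; and
    [P^n v (x) = +oo] when [x = T^n beta]. *)

(** The delicate point at the pole is the inverse branch that leaves the orbit of [beta]. If [x] and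
    the current orbit point [c] are both close to 1, then both preimages of [x] are close to 1/2, so
    this branch meets the singularity too, with size about (2 - x - c)^(-a). The orbit may return
    near 1/2 again and again, so such secondary singularities can be born at any time. They stay
    under control because the turning point has the orbit 1/2 -> 1 -> 0 -> 0. A singularity at 1
    moves in one step to the fixed point 0, and there the branch [f0] only rescales it, by a factor
    (2-r)^(-(1-a)). The families [Gk] (along the orbit), [Uk] (at 1) and [Jk] (at 0) are thus closed
    under the operator up to bounded errors, and bounded errors remain bounded because the constant
    1 lies below a multiple of the invariant density. The assumption r < 1 enters twice: it makes 0
    a strictly repelling fixed point, and it bounds the parameter t, hence all distortion. *)

Definition in01 (x : R) : Prop := 0 <= x <= 1.

Lemma div_le_of_le_mul a b c : 0 < c -> a <= b * c -> a / c <= b.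
Proof. intros Hc H; apply (proj2 (Rle_div_l a b c Hc)); lra. Qed.

Lemma le_div_of_mul_le a b c : 0 < c -> a * c <= b -> a <= b / c.
Proof. intros Hc H; apply (proj1 (Rle_div_r a b c Hc)); lra. Qed.

(** * The map [T] and its two inverse branches *)

Lemma f0_den_pos r x : 0 <= r < 1 -> in01 x -> 0 < 2 - r + r * x.
Proof. unfold in01; intros; nra. Qed.

Lemma f1_eq r x : 0 <= r < 1 -> in01 x -> f1 r x = 1 - f0 r x.
Proof.
  intros Hr Hx; pose proof (f0_den_pos r x Hr Hx).
  unfold f0, f1; field; lra.
Qed.

Lemma f0_range r x : 0 <= r < 1 -> in01 x -> 0 <= f0 r x <= 1 / 2.
Proof.
  intros Hr Hx; pose proof (f0_den_pos r x Hr Hx) as Hd; unfold f0, in01 in *.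
  split.
  - apply Rdiv_le_0_compat; lra.
  - apply div_le_of_le_mul; nra.
Qed.

Lemma f0_in01 r x : 0 <= r < 1 -> in01 x -> in01 (f0 r x).
Proof. intros Hr Hx; pose proof (f0_range r x Hr Hx); unfold in01; lra. Qed.

Lemma f1_range r x : 0 <= r < 1 -> in01 x -> 1 / 2 <= f1 r x <= 1.
Proof. intros Hr Hx; rewrite f1_eq by auto; pose proof (f0_range r x Hr Hx); lra. Qed.

Lemma f1_in01 r x : 0 <= r < 1 -> in01 x -> in01 (f1 r x).
Proof. intros Hr Hx; pose proof (f1_range r x Hr Hx); unfold in01; lra. Qed.

Lemma f0_sub r x y : 0 <= r < 1 -> in01 x -> in01 y ->
  f0 r x - f0 r y = (2 - r) * (x - y) / ((2 - r + r * x) * (2 - r + r * y)).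
Proof.
  intros Hr Hx Hy; pose proof (f0_den_pos r x Hr Hx); pose proof (f0_den_pos r y Hr Hy).
  unfold f0; field; lra.
Qed.

(** The two branches merge at 1/2 only for x = 1. Since the gap is at least linear in 1 - x, their
    interaction is a power singularity with unchanged exponent. *)
Lemma f0_half_gap r x : 0 <= r < 1 -> in01 x -> (1 - x) / 4 <= 1 / 2 - f0 r x.
Proof.
  intros Hr Hx; pose proof (f0_den_pos r x Hr Hx) as Hd; unfold f0, in01 in *.
  replace (1 / 2 - x / (2 - r + r * x)) with ((2 - r) * (1 - x) / (2 * (2 - r + r * x)))
    by (field; lra).
  apply le_div_of_mul_le; [lra|].
  assert (0 <= (1 - x) * (2 - r - (2 - r + r * x) / 2)) by (apply Rmult_le_pos; nra).
  nra.
Qed.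

Lemma w0_pos r x : 0 <= r < 1 -> in01 x -> 0 < w0 r x.
Proof.
  intros Hr Hx; pose proof (f0_den_pos r x Hr Hx).
  unfold w0; apply Rdiv_lt_0_compat; [lra | nra].
Qed.

Lemma T_f0 r x : 0 <= r < 1 -> in01 x -> T r (f0 r x) = x.
Proof.
  intros Hr Hx; pose proof (f0_den_pos r x Hr Hx); pose proof (f0_range r x Hr Hx).
  unfold T; destruct (Rle_dec _ _); [|lra].
  unfold f0; field; split; [lra|].
  replace (2 - r + r * x - r * x) with (2 - r) by ring; lra.
Qed.

Lemma T_sym r x : 0 <= r < 1 -> T r (1 - x) = T r x.
Proof.
  intros Hr; unfold T; destruct (Rle_dec (1 - x) (1/2)), (Rle_dec x (1/2)); try lra.
  - assert (x = 1/2) by lra; subst. f_equal; lra.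
  - replace (1 - r * (1 - x)) with (1 - r + r * x) by ring; reflexivity.
  - replace (1 - (1 - x)) with x by ring.
    replace (1 - r + r * (1 - x)) with (1 - r * x) by ring; reflexivity.
Qed.

Lemma T_f1 r x : 0 <= r < 1 -> in01 x -> T r (f1 r x) = x.
Proof. intros Hr Hx; rewrite f1_eq, T_sym by auto; apply T_f0; auto. Qed.

Lemma f0_T_le_half r x : 0 <= r < 1 -> in01 x -> x <= 1 / 2 -> in01 (T r x) /\ f0 r (T r x) = x.
Proof.
  intros Hr Hx Hh; unfold in01 in *.
  assert (Hd : 0 < 1 - r * x) by nra.
  unfold T; destruct (Rle_dec _ _); [|lra]. split; [split|].
  - apply Rdiv_le_0_compat; nra.
  - apply div_le_of_le_mul; nra.
  - unfold f0; field; split; [lra|]. intros E; nra.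
Qed.

Lemma f1_T_ge_half r x : 0 <= r < 1 -> in01 x -> 1 / 2 <= x -> in01 (T r x) /\ f1 r (T r x) = x.
Proof.
  intros Hr Hx Hh; destruct (f0_T_le_half r (1 - x)) as [H1 H2]; unfold in01 in *; try lra.
  rewrite T_sym in H1, H2 by auto; split; [auto|].
  rewrite f1_eq, H2 by auto; ring.
Qed.

Lemma T_in01 r x : 0 <= r < 1 -> in01 x -> in01 (T r x).
Proof.
  intros Hr Hx; destruct (Rle_dec x (1/2)).
  - apply f0_T_le_half; auto.
  - apply f1_T_ge_half; auto; lra.
Qed.

Lemma iter_T_in01 r n x : 0 <= r < 1 -> in01 x -> in01 (Nat.iter n (T r) x).
Proof. intros Hr Hx; induction n; simpl; auto using T_in01. Qed.

Lemma T_preimage r x : 0 <= r < 1 -> in01 x -> x = f0 r (T r x) \/ x = f1 r (T r x).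
Proof.
  intros Hr Hx; destruct (Rle_dec x (1/2)).
  - left; symmetry; apply f0_T_le_half; auto.
  - right; symmetry; apply f1_T_ge_half; auto; lra.
Qed.

(** Of the two preimages of [T r x], the one given by [f0] is the smaller. It can replace [x] in the
    argument of a decreasing power. *)
Lemma f0_T_le r x : 0 <= r < 1 -> in01 x -> f0 r (T r x) <= x.
Proof.
  intros Hr Hx; destruct (Rle_dec x (1/2)).
  - right; apply f0_T_le_half; auto.
  - pose proof (f0_range r (T r x) Hr (T_in01 r x Hr Hx)); lra.
Qed.

Lemma f0_T_le_compl r x : 0 <= r < 1 -> in01 x -> f0 r (T r x) <= 1 - x.
Proof.
  intros Hr Hx; rewrite <- (T_sym r x Hr); apply f0_T_le; unfold in01 in *; lra.
Qed.

(** * The transfer operator on real-valued functions *)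

Definition PR (r : R) (f : R -> R) (x : R) : R :=
  w0 r x * (f (f0 r x) + f (f1 r x)).

Fixpoint PRn (r : R) (n : nat) (f : R -> R) : R -> R :=
  match n with O => f | S m => PR r (PRn r m f) end.

Lemma PRn_add r m n f : PRn r (m + n) f = PRn r m (PRn r n f).
Proof. induction m; simpl; [|rewrite IHm]; reflexivity. Qed.

Lemma PRn_succ_r r n f : PRn r (S n) f = PRn r n (PR r f).
Proof.
  replace (S n) with (n + 1)%nat by lia. apply PRn_add.
Qed.

(** T^n maps every n-th preimage of [x] to [x], so none of them is [c] unless x = T^n c. This keeps
    the value at the pole out of all real-valued estimates. *)
Lemma PRn_le_avoid r n f g c x : 0 <= r < 1 -> in01 x -> x <> Nat.iter n (T r) c ->
  (forall z, in01 z -> z <> c -> f z <= g z) -> PRn r n f x <= PRn r n g x.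
Proof.
  intros Hr Hx Hne Hfg; revert x Hx Hne; induction n; intros x Hx Hne; simpl in *.
  { auto. }
  pose proof (w0_pos r x Hr Hx). unfold PR.
  apply Rmult_le_compat_l; [lra|]. apply Rplus_le_compat; apply IHn.
  - apply f0_in01; auto.
  - intros E; apply Hne; rewrite <- E; symmetry; apply T_f0; auto.
  - apply f1_in01; auto.
  - intros E; apply Hne; rewrite <- E; symmetry; apply T_f1; auto.
Qed.

Lemma PRn_le r n f g x : 0 <= r < 1 -> in01 x ->
  (forall z, in01 z -> f z <= g z) -> PRn r n f x <= PRn r n g x.
Proof.
  intros Hr Hx Hfg; revert x Hx; induction n; intros x Hx; simpl in *; auto.
  pose proof (w0_pos r x Hr Hx). unfold PR.
  apply Rmult_le_compat_l; [lra|]. apply Rplus_le_compat; apply IHn; auto using f0_in01, f1_in01.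
Qed.

Lemma PRn_ext r n f g x : 0 <= r < 1 -> in01 x ->
  (forall z, in01 z -> f z = g z) -> PRn r n f x = PRn r n g x.
Proof.
  intros Hr Hx Hfg; apply Rle_antisym; apply PRn_le; auto; intros; rewrite Hfg; auto; lra.
Qed.

Lemma PRn_lin r n a b f g x :
  PRn r n (fun z => a * f z + b * g z) x = a * PRn r n f x + b * PRn r n g x.
Proof.
  revert x; induction n; intros x; simpl; [reflexivity|].
  unfold PR; rewrite !IHn; ring.
Qed.

Lemma PRn_scal r n a f x : PRn r n (fun z => a * f z) x = a * PRn r n f x.
Proof.
  revert x; induction n; intros x; simpl; [reflexivity|].
  unfold PR; rewrite !IHn; ring.
Qed.

(** The invariant density up to normalisation, in a form that includes r = 0. *)
Definition hh (r x : R) : R := 1 / (1 - r + r * x).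

Lemma hh_bound r x : 0 <= r < 1 -> in01 x -> 1 <= hh r x <= / (1 - r).
Proof.
  unfold in01, hh; intros Hr Hx; assert (0 < 1 - r + r * x) by nra. split.
  - apply le_div_of_mul_le; nra.
  - unfold Rdiv; rewrite Rmult_1_l; apply Rinv_le_contravar; nra.
Qed.

Lemma PR_hh r x : 0 <= r < 1 -> in01 x -> PR r (hh r) x = hh r x.
Proof.
  intros Hr Hx; pose proof (f0_den_pos r x Hr Hx). unfold PR, hh, w0, f0, f1; unfold in01 in Hx.
  assert (0 < 1 - r + r * x) by nra.
  assert (0 < (1 - r) * (2 - r + r * x) + r * x) by nra.
  field. repeat split; try lra.
Qed.

Lemma PRn_hh r n x : 0 <= r < 1 -> in01 x -> PRn r n (hh r) x = hh r x.
Proof.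
  intros Hr Hx; induction n as [|n IH]; [reflexivity|].
  rewrite PRn_succ_r, <- IH. apply PRn_ext; auto using PR_hh.
Qed.

Lemma PRn_one_bound r n x : 0 <= r < 1 -> in01 x -> 0 <= PRn r n (fun _ => 1) x <= / (1 - r).
Proof.
  intros Hr Hx; split.
  - rewrite <- (Rmult_0_l (PRn r n (fun _ => 1) x)), <- PRn_scal.
    apply PRn_le; auto; intros; lra.
  - apply Rle_trans with (hh r x); [|apply hh_bound; auto].
    rewrite <- (PRn_hh r n x) by auto. apply PRn_le; auto. intros; apply hh_bound; auto.
Qed.

(** * Calculus of Moebius inverse branches *)

Definition branch (r : R) (j : bool) : R -> R := if j then f1 r else f0 r.
(** If a Moebius map has derivative k / (1 + t x)^2 up to sign, its composition with [branch r j]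
    applied first has parameter [tau r j t] and constant [kfac r j t * k]. *)
Definition tau (r : R) (j : bool) (t : R) : R :=
  if j then (/ (1 + t) - (1 - r)) / (2 - r) else (t + r) / (2 - r).
Definition kfac (r : R) (j : bool) (t : R) : R :=
  if j then / ((2 - r) * (1 + t) ^ 2) else / (2 - r).
Definition sgb (j : bool) : R := if j then -1 else 1.
(** The interval 0 <= t <= r / (1 - r), written without division; its upper end is the fixed point
    of [tau r false]. It yields the distortion bound 1 <= 1 + t x <= 1 / (1 - r). *)
Definition okt (r t : R) : Prop := 0 <= t /\ (1 - r) * (1 + t) <= 1.

Lemma branch_in01 r j x : 0 <= r < 1 -> in01 x -> in01 (branch r j x).
Proof. intros; destruct j; simpl; auto using f0_in01, f1_in01. Qed.

Lemma okt_tau r j t : 0 <= r < 1 -> okt r t -> okt r (tau r j t).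
Proof.
  unfold okt; intros Hr [H0 H1]; destruct j; simpl.
  - assert (1 - r <= / (1 + t)).
    { apply Rmult_le_reg_r with (1 + t); [lra|]. rewrite Rinv_l; lra. }
    assert (/ (1 + t) <= 1).
    { rewrite <- Rinv_1 at 2; apply Rinv_le_contravar; lra. }
    split.
    + apply Rdiv_le_0_compat; lra.
    + assert ((/ (1 + t) - (1 - r)) / (2 - r) <= r / (2 - r)).
      { unfold Rdiv; apply Rmult_le_compat_r; [|lra].
        left; apply Rinv_0_lt_compat; lra. }
      assert ((1 - r) * (1 + r / (2 - r)) <= 1); [|nra].
      replace ((1 - r) * (1 + r / (2 - r))) with (2 * (1 - r) / (2 - r)) by (field; lra).
      apply div_le_of_le_mul; lra.
  - split.
    + apply Rdiv_le_0_compat; lra.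
    + replace ((1 - r) * (1 + (t + r) / (2 - r))) with ((1 - r) * (2 + t) / (2 - r)) by (field; lra).
      apply div_le_of_le_mul; lra.
Qed.

Lemma okt_0 r : 0 <= r < 1 -> okt r 0.
Proof. unfold okt; lra. Qed.

Lemma okt_den r t x : 0 <= r < 1 -> okt r t -> in01 x -> 1 <= 1 + t * x /\ (1 - r) * (1 + t * x) <= 1.
Proof.
  unfold okt, in01; intros Hr [H0 H1] Hx; split; [nra|].
  assert (t * x <= t) by nra. nra.
Qed.

Lemma kfac_bound r j t : 0 <= r < 1 -> 0 <= t -> 0 < kfac r j t <= / (2 - r).
Proof.
  intros Hr Ht; destruct j; simpl.
  - split; [apply Rinv_0_lt_compat; nra|]. apply Rinv_le_contravar; nra.
  - split; [apply Rinv_0_lt_compat; lra | lra].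
Qed.

Lemma branch_den r j t x : 0 <= r < 1 -> 0 <= t -> in01 x ->
  1 + t * branch r j x =
  (if j then 1 + t else 1) * (2 - r) * (1 + tau r j t * x) / (2 - r + r * x).
Proof.
  intros Hr Ht Hx; pose proof (f0_den_pos r x Hr Hx).
  destruct j; simpl; unfold f0, f1; field; lra.
Qed.

Lemma tau_den_pos r j t x : 0 <= r < 1 -> okt r t -> in01 x -> 0 < 1 + tau r j t * x.
Proof.
  intros Hr Ht Hx; pose proof (okt_den r _ x Hr (okt_tau r j t Hr Ht) Hx); lra.
Qed.

Lemma branch_weight r j t x : 0 <= r < 1 -> okt r t -> in01 x ->
  w0 r x / (1 + t * branch r j x) ^ 2 = kfac r j t / (1 + tau r j t * x) ^ 2.
Proof.
  intros Hr Ht Hx; pose proof (f0_den_pos r x Hr Hx).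
  pose proof (tau_den_pos r j t x Hr Ht Hx) as Hd. destruct Ht as [Ht _].
  rewrite branch_den by auto. revert Hd; generalize (1 + tau r j t * x); intros u Hd.
  unfold w0, kfac; destruct j; field; lra.
Qed.

(** Moebius maps satisfy (M x - M y)^2 = |M' x| |M' y| (x - y)^2 exactly. Because this is an
    identity and not a mean value estimate, distances to the orbit are transported without
    accumulating distortion constants. *)
Lemma branch_diff r j t x y : 0 <= r < 1 -> okt r t -> in01 x -> in01 y ->
  (branch r j x - branch r j y) / ((1 + t * branch r j x) * (1 + t * branch r j y)) =
  sgb j * kfac r j t * (x - y) / ((1 + tau r j t * x) * (1 + tau r j t * y)).
Proof.
  intros Hr Ht Hx Hy; pose proof (f0_den_pos r x Hr Hx); pose proof (f0_den_pos r y Hr Hy).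
  pose proof (tau_den_pos r j t x Hr Ht Hx) as Hd.
  pose proof (tau_den_pos r j t y Hr Ht Hy) as Hd'. destruct Ht as [Ht _].
  assert (E : branch r j x - branch r j y =
    sgb j * ((2 - r) * (x - y) / ((2 - r + r * x) * (2 - r + r * y)))).
  { rewrite <- f0_sub by auto. destruct j; simpl; [rewrite !f1_eq by auto|]; ring. }
  rewrite E, !branch_den by auto. revert Hd Hd'.
  generalize (1 + tau r j t * x) (1 + tau r j t * y); intros u u' Hd Hd'.
  unfold kfac; destruct j; field; lra.
Qed.

(** * Propagation of a power singularity *)

Definition pw (a z : R) : R := Rpower z (- a).
(** Pulling a pole of exponent [a] back through a branch of slope [k] multiplies it by k * k^(-a) =
    k^(1-a), which is below 1 when k < 1 and a < 1. *)
Definition k1 (a k : R) : R := k * pw a k.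

Lemma pw_pos a z : 0 < pw a z.
Proof. apply exp_pos. Qed.

Lemma pw_mult a x y : 0 < x -> 0 < y -> pw a (x * y) = pw a x * pw a y.
Proof. intros; unfold pw; symmetry; apply Rpower_mult_distr; auto. Qed.

Lemma pw_anti a x y : 0 <= a -> 0 < x <= y -> pw a y <= pw a x.
Proof.
  intros Ha H; unfold pw; rewrite !Rpower_Ropp.
  apply Rinv_le_contravar; [apply exp_pos | apply Rle_Rpower_l; auto].
Qed.

Lemma pw_scale_le a c x y : 0 <= a -> 0 < c -> 0 < x -> c * x <= y -> pw a y <= pw a c * pw a x.
Proof.
  intros; rewrite <- pw_mult by auto; apply pw_anti; auto; split; auto; nra.
Qed.

Lemma k1_eq a k : 0 < k -> k1 a k = Rpower k (1 - a).
Proof.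
  intros; unfold k1, pw, Rminus; rewrite Rpower_plus, Rpower_1; auto.
Qed.

Lemma k1_pos a k : 0 < k -> 0 < k1 a k.
Proof. intros; apply Rmult_lt_0_compat; auto using pw_pos. Qed.

Definition theta (r a : R) : R := k1 a (/ (2 - r)).

Lemma theta_bound r a : 0 <= r < 1 -> 0 < a < 1 -> 0 < theta r a < 1.
Proof.
  intros Hr Ha; assert (0 < / (2 - r)) by (apply Rinv_0_lt_compat; lra).
  split; [apply k1_pos; auto|]. unfold theta; rewrite k1_eq by auto.
  unfold Rpower. apply Rlt_le_trans with (exp 0); [apply exp_increasing | rewrite exp_0; lra].
  assert (ln (/ (2 - r)) < 0).
  { rewrite <- ln_1; apply ln_increasing; auto.
    rewrite <- Rinv_1; apply Rinv_lt_contravar; lra. }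
  nra.
Qed.

Lemma k1_le_theta r a k k' : 0 <= r < 1 -> 0 < a < 1 -> 0 < k -> 0 < k' <= / (2 - r) * k ->
  k1 a k' <= theta r a * k1 a k.
Proof.
  intros Hr Ha Hk Hk'; assert (0 < / (2 - r)) by (apply Rinv_0_lt_compat; lra).
  unfold theta; rewrite !k1_eq by lra. rewrite Rpower_mult_distr by auto.
  apply Rle_Rpower_l; lra.
Qed.

Lemma div_sq_le k d : 0 < k -> 1 <= d -> 0 < k / d ^ 2 <= k.
Proof.
  intros; assert (1 <= d ^ 2) by nra. split; [apply Rdiv_lt_0_compat; lra|].
  apply div_le_of_le_mul; nra.
Qed.

(* The contribution to [P^n pw a |. - beta|] of the inverse branch that follows
   the orbit of [beta]; [c] stands for [T^n beta]. *)
Definition Gk (a k t c x : R) : R :=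
  k / (1 + t * x) ^ 2 * pw a (k * Rabs (x - c) / ((1 + t * x) * (1 + t * c))).

(** Models the contribution of the inverse branch that leaves the orbit: large only when [x] and [c]
    are both near 1, where the two preimages of a point merge. *)
Definition Uk (a c x : R) : R := pw a (2 - x - c).

(* The same for the singularity at the fixed point [0], reflected so that [c]
   lies on the other side of it. *)
Definition Jk (a k t c x : R) : R :=
  k / (1 + t * x) ^ 2 * pw a (k * (x / (1 + t * x)) + k * (c / (1 + t * c))).

Lemma PR_branch r j f x : PR r f x = w0 r x * f (branch r j x) + w0 r x * f (branch r (negb j) x).
Proof. unfold PR; destruct j; simpl; ring. Qed.

(** The two points lie on opposite sides of 1/2, so their distances to 1/2 add up. *)
Lemma branch_gap r j x c : 0 <= r < 1 -> in01 x -> in01 c ->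
  (2 - x - c) / 4 <= Rabs (branch r (negb j) x - branch r j c).
Proof.
  intros Hr Hx Hc; pose proof (f0_half_gap r x Hr Hx); pose proof (f0_half_gap r c Hr Hc).
  destruct j; simpl; rewrite f1_eq by auto; unfold Rabs; destruct (Rcase_abs _); lra.
Qed.

(** The branch through [c] reproduces [Gk] exactly, by [branch_weight] and [branch_diff]; the other
    branch costs a [Uk]. The new [k'] and [t'] do not depend on [x], so the estimate can be
    iterated. *)
Lemma PR_Gk r a k t c : 0 <= r < 1 -> 0 < a < 1 -> 0 < k -> okt r t -> in01 c ->
  exists k' t', 0 < k' <= / (2 - r) * k /\ okt r t' /\
  forall x, in01 x -> x <> T r c ->
    PR r (Gk a k t c) x <= Gk a k' t' (T r c) x
       + k1 a k * pw a ((1 - r) ^ 2 / 4) * Uk a (T r c) x.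
Proof.
  intros Hr Ha Hk Ht Hc.
  assert (Hj : exists j, c = branch r j (T r c)).
  { destruct (T_preimage r c Hr Hc); [exists false | exists true]; auto. }
  destruct Hj as [j Hj].
  pose proof (T_in01 r c Hr Hc) as Hc'.
  pose proof (kfac_bound r j t Hr (proj1 Ht)) as Hkf.
  pose proof (okt_tau r j t Hr Ht) as Ht'.
  exists (kfac r j t * k), (tau r j t); split; [|split; auto].
  { split; [apply Rmult_lt_0_compat; lra | apply Rmult_le_compat_r; lra]. }
  intros x Hx Hne. rewrite (PR_branch r j).
  assert (Hb := branch_in01 r (negb j) x Hr Hx).
  apply Rplus_le_compat.
  - right; unfold Gk. rewrite <- Rmult_assoc. f_equal.
    + replace (w0 r x * (k / (1 + t * branch r j x) ^ 2))
        with (k * (w0 r x / (1 + t * branch r j x) ^ 2))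
        by (unfold Rdiv; ring).
      rewrite branch_weight by auto. unfold Rdiv; ring.
    + f_equal. set (c' := T r c) in *. rewrite Hj.
      pose proof (okt_den r t _ Hr Ht (branch_in01 r j x Hr Hx)).
      pose proof (okt_den r t _ Hr Ht (branch_in01 r j c' Hr Hc')).
      pose proof (okt_den r _ _ Hr Ht' Hx). pose proof (okt_den r _ _ Hr Ht' Hc').
      pose proof (branch_diff r j t x c' Hr Ht Hx Hc') as E. apply (f_equal Rabs) in E.
      revert E; unfold Rdiv; rewrite !Rabs_mult, !Rabs_inv, !Rabs_mult.
      rewrite (Rabs_pos_eq (1 + t * branch r j x)), (Rabs_pos_eq (1 + t * branch r j c')),
        (Rabs_pos_eq (1 + tau r j t * x)), (Rabs_pos_eq (1 + tau r j t * c')),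
        (Rabs_pos_eq (kfac r j t)) by lra.
      replace (Rabs (sgb j)) with 1
        by (destruct j; simpl; unfold Rabs; destruct (Rcase_abs _); lra).
      intros E. rewrite Rmult_assoc, E. ring.
  - unfold Gk. rewrite <- Rmult_assoc. rewrite (Rmult_assoc (k1 a k)).
    pose proof (okt_den r t _ Hr Ht Hb) as D1. pose proof (okt_den r t c Hr Ht Hc) as D2.
    pose proof (okt_den r _ x Hr (okt_tau r (negb j) t Hr Ht) Hx) as D3.
    pose proof (kfac_bound r (negb j) t Hr (proj1 Ht)) as Hkf'.
    (* As [x] and [T r c] differ, they cannot both be 1. *)
    assert (Hpos : 0 < 2 - x - T r c).
    { unfold in01 in *. destruct (Req_dec x 1), (Req_dec (T r c) 1); try lra. }
    assert (W : w0 r x * (k / (1 + t * branch r (negb j) x) ^ 2) <= k).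
    { replace (w0 r x * (k / (1 + t * branch r (negb j) x) ^ 2))
        with (k * (w0 r x / (1 + t * branch r (negb j) x) ^ 2)) by (unfold Rdiv; ring).
      rewrite branch_weight by auto.
      pose proof (div_sq_le (kfac r (negb j) t) (1 + tau r (negb j) t * x)).
      assert (/ (2 - r) <= 1) by (rewrite <- Rinv_1; apply Rinv_le_contravar; lra).
      nra. }
    (* The 1/4 comes from [branch_gap], each factor 1 - r from a denominator bounded by 1 / (1 -
       r). *)
    assert (Hq : 0 < (1 - r) ^ 2 / 4) by nra.
    unfold k1. rewrite (Rmult_assoc k).
    apply Rmult_le_compat; auto.
    + apply Rmult_le_pos; [left; apply w0_pos; auto|]. left; apply div_sq_le; lra.
    + left; apply pw_pos.
    + rewrite <- Rmult_assoc, <- pw_mult by auto.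
      apply pw_scale_le; auto; [lra|apply Rmult_lt_0_compat; auto|].
      pose proof (branch_gap r j x (T r c) Hr Hx Hc') as Gp. rewrite <- Hj in Gp.
      apply Rle_trans with (k * ((1 - r) ^ 2 * Rabs (branch r (negb j) x - c))).
      { replace (k * ((1 - r) ^ 2 / 4) * (2 - x - T r c))
          with (k * ((1 - r) ^ 2 * ((2 - x - T r c) / 4))) by field.
        apply Rmult_le_compat_l; [lra|]. apply Rmult_le_compat_l; [nra|auto]. }
      unfold Rdiv; rewrite Rmult_assoc. apply Rmult_le_compat_l; [lra|].
      rewrite Rmult_comm. apply Rmult_le_compat_l; [apply Rabs_pos|].
      apply Rmult_le_reg_r with ((1 + t * branch r (negb j) x) * (1 + t * c)); [nra|].
      rewrite Rinv_l by nra.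
      replace ((1 - r) ^ 2 * ((1 + t * branch r (negb j) x) * (1 + t * c))) with
       (((1 - r) * (1 + t * branch r (negb j) x)) * ((1 - r) * (1 + t * c))) by ring.
      rewrite <- (Rmult_1_l 1) at 5. apply Rmult_le_compat; nra.
Qed.

Lemma div_den_mono t x y : 0 <= t -> 0 <= x <= y -> x / (1 + t * x) <= y / (1 + t * y).
Proof.
  intros; assert (0 < 1 + t * x) by nra. assert (0 < 1 + t * y) by nra.
  apply div_le_of_le_mul; auto.
  replace (y / (1 + t * y) * (1 + t * x)) with (y * (1 + t * x) / (1 + t * y)) by (field; lra).
  apply le_div_of_mul_le; nra.
Qed.

(** y / (1 + t y) is the Moebius map fixing 0 with derivative 1 / (1 + t y)^2. Since [f0] fixes 0 as
    well, composing with it stays in this family. *)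
Lemma f0_div_den r t x : 0 <= r < 1 -> okt r t -> in01 x ->
  f0 r x / (1 + t * f0 r x) = / (2 - r) * (x / (1 + tau r false t * x)).
Proof.
  intros Hr Ht Hx; pose proof (branch_den r false t x Hr (proj1 Ht) Hx) as E; simpl branch in E.
  rewrite E; pose proof (f0_den_pos r x Hr Hx).
  pose proof (tau_den_pos r false t x Hr Ht Hx). unfold f0.
  revert H0; generalize (1 + tau r false t * x); intros; field; lra.
Qed.

Lemma le_div_den r t x : 0 <= r < 1 -> okt r t -> in01 x -> (1 - r) * x <= x / (1 + t * x).
Proof.
  intros Hr Ht Hx; pose proof (okt_den r t x Hr Ht Hx). unfold in01 in Hx.
  apply le_div_of_mul_le; nra.
Qed.

Lemma w0_le_one r x : 0 <= r < 1 -> in01 x -> w0 r x <= 1.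
Proof.
  intros Hr Hx; unfold w0, in01 in *; assert (2 - r <= 2 - r + r * x) by nra.
  apply div_le_of_le_mul; nra.
Qed.

(** The branch [f0] keeps the singularity at 0 and divides [k] by 2 - r; the branch [f1] has values
    at least 1/2, where [Jk] is bounded. No further kind of singularity arises. *)
Lemma PR_Jk r a k t c x : 0 <= r < 1 -> 0 < a < 1 -> 0 < k -> okt r t -> in01 c ->
  in01 x -> x <> T r c ->
  PR r (Jk a k t c) x <= Jk a (/ (2 - r) * k) (tau r false t) (T r c) x
       + k1 a k * pw a ((1 - r) / 2).
Proof.
  intros Hr Ha Hk Ht Hc Hx Hne.
  pose proof (T_in01 r c Hr Hc) as Hc'. pose proof (okt_tau r false t Hr Ht) as Ht'.
  assert (Hi : 0 < / (2 - r)) by (apply Rinv_0_lt_compat; lra).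
  rewrite (PR_branch r false); simpl negb. apply Rplus_le_compat.
  - unfold Jk. rewrite <- Rmult_assoc.
    replace (w0 r x * (k / (1 + t * branch r false x) ^ 2))
        with (k * (w0 r x / (1 + t * branch r false x) ^ 2)) by (unfold Rdiv; ring).
    rewrite branch_weight by auto. simpl branch. simpl kfac.
    replace (k * (/ (2 - r) / (1 + tau r false t * x) ^ 2))
      with (/ (2 - r) * k / (1 + tau r false t * x) ^ 2) by (unfold Rdiv; ring).
    pose proof (okt_den r _ x Hr Ht' Hx) as Dx.
    apply Rmult_le_compat_l.
    { left; apply div_sq_le; [nra|lra]. }
    apply pw_anti; [lra|].
    rewrite f0_div_den by auto.
    (* The point [c] is replaced by the smaller preimage of [T r c], which only enlarges the
       decreasing power. *)
    pose proof (div_den_mono t (f0 r (T r c)) c (proj1 Ht)) as M.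
    rewrite f0_div_den in M by auto.
    pose proof (f0_T_le r c Hr Hc). pose proof (f0_range r _ Hr Hc').
    specialize (M ltac:(lra)).
    split.
    + pose proof (le_div_den r _ x Hr Ht' Hx). pose proof (le_div_den r _ _ Hr Ht' Hc').
      assert (0 < x + T r c).
      { unfold in01 in *; destruct (Req_dec x 0), (Req_dec (T r c) 0); lra. }
      rewrite <- Rmult_plus_distr_l. apply Rmult_lt_0_compat; [nra|].
      apply Rlt_le_trans with ((1 - r) * (x + T r c)); [nra|lra].
    + rewrite (Rmult_comm (/ (2 - r)) k), !(Rmult_assoc k).
      apply Rplus_le_compat_l. apply Rmult_le_compat_l; lra.
  - unfold Jk. rewrite <- Rmult_assoc. simpl branch.
    pose proof (f1_in01 r x Hr Hx) as Hb. pose proof (f1_range r x Hr Hx) as Hb'.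
    pose proof (okt_den r t _ Hr Ht Hb) as D1. pose proof (okt_den r t _ Hr Ht Hc) as D2.
    unfold k1; rewrite (Rmult_assoc k).
    pose proof (div_sq_le k (1 + t * f1 r x) Hk (proj1 D1)).
    pose proof (w0_le_one r x Hr Hx). pose proof (w0_pos r x Hr Hx).
    apply Rmult_le_compat.
    + nra.
    + left; apply pw_pos.
    + nra.
    + rewrite <- pw_mult by lra. apply pw_anti; [lra|].
      split; [apply Rmult_lt_0_compat; lra|].
      rewrite <- Rmult_plus_distr_l. apply Rmult_le_compat_l; [lra|].
      pose proof (le_div_den r t _ Hr Ht Hb). pose proof (le_div_den r t _ Hr Ht Hc).
      unfold in01 in *; nra.
Qed.

Lemma PRn_le_split r n f g C c x : 0 <= r < 1 -> in01 x -> x <> Nat.iter n (T r) c -> 0 <= C ->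
  (forall z, in01 z -> z <> c -> f z <= g z + C) ->
  PRn r n f x <= PRn r n g x + C * / (1 - r).
Proof.
  intros Hr Hx Hne HC H.
  apply Rle_trans with (PRn r n (fun z => 1 * g z + C * 1) x).
  { apply PRn_le_avoid with c; auto. intros z Hz Hzc; specialize (H z Hz Hzc); lra. }
  rewrite (PRn_lin r n 1 C g (fun _ => 1)).
  pose proof (PRn_one_bound r n x Hr Hx). nra.
Qed.

(** Relative to [k1 a k], each step contracts by [theta] and adds an error [C]; [B] solves theta B +
    C = B. The statement ranges over [k], [t] and [c] because the induction peels off the first
    application of [PR], which changes all three. *)
Lemma PRn_Jk r a : 0 <= r < 1 -> 0 < a < 1 ->
  exists B D, 0 < B /\ 0 < D /\ forall n k t c x, 0 < k -> okt r t -> in01 c ->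
  in01 x -> x <> Nat.iter n (T r) c ->
  PRn r n (Jk a k t c) x <=
    k1 a k * (B + D * theta r a ^ n * pw a (Rabs (x - Nat.iter n (T r) c))).
Proof.
  intros Hr Ha. pose proof (theta_bound r a Hr Ha) as Hth.
  set (C := pw a ((1 - r) / 2) * / (1 - r)).
  assert (HC : 0 < C).
  { apply Rmult_lt_0_compat; [apply pw_pos|apply Rinv_0_lt_compat; lra]. }
  exists (C / (1 - theta r a)), (pw a (1 - r)).
  split; [apply Rdiv_lt_0_compat; lra|]. split; [apply pw_pos|].
  set (B := C / (1 - theta r a)).
  assert (HB : theta r a * B + C = B) by (unfold B; field; lra).
  assert (HB0 : 0 < B) by (apply Rdiv_lt_0_compat; lra).
  induction n as [|n IH]; intros k t c x Hk Ht Hc Hx Hne.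
  - simpl in *. unfold Jk.
    pose proof (okt_den r t x Hr Ht Hx) as Dx. pose proof (okt_den r t c Hr Ht Hc) as Dc.
    pose proof (div_sq_le k (1 + t * x) Hk (proj1 Dx)).
    assert (0 < Rabs (x - c)) by (apply Rabs_pos_lt; lra).
    (* Trades the reflected distance for the true one, so that the final bounds involve only the
       distance to the orbit. *)
    assert (Rabs (x - c) <= x + c).
    { unfold in01 in *; unfold Rabs; destruct (Rcase_abs _); lra. }
    apply Rle_trans with (k * (pw a k * (pw a (1 - r) * pw a (Rabs (x - c))))).
    + apply Rmult_le_compat; try lra; [left; apply pw_pos|].
      rewrite <- !pw_mult by nra. apply pw_anti; [lra|]. split; [repeat apply Rmult_lt_0_compat; lra|].
      rewrite <- Rmult_plus_distr_l. apply Rmult_le_compat_l; [lra|].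
      pose proof (le_div_den r t _ Hr Ht Hx). pose proof (le_div_den r t _ Hr Ht Hc). nra.
    + pose proof (k1_pos a k Hk). unfold k1 in *. nra.
  - rewrite PRn_succ_r. rewrite Nat.iter_succ_r in Hne |- *.
    assert (Hi : 0 < / (2 - r)) by (apply Rinv_0_lt_compat; lra).
    pose proof (k1_pos a k Hk) as Hk1.
    eapply Rle_trans.
    { apply PRn_le_split with (c := T r c) (g := Jk a (/ (2 - r) * k) (tau r false t) (T r c))
        (C := k1 a k * pw a ((1 - r) / 2)); auto.
      - left; apply Rmult_lt_0_compat; auto; apply pw_pos.
      - intros z Hz Hzc; apply PR_Jk; auto. }
    eapply Rle_trans.
    { apply Rplus_le_compat_r. apply IH; auto using okt_tau, T_in01. nra. }
    fold (B). rewrite (Rmult_assoc (k1 a k)). fold C.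
    set (Y := pw a (Rabs (x - Nat.iter n (T r) (T r c)))).
    assert (HY : 0 < Y) by apply pw_pos.
    assert (HX : 0 < B + pw a (1 - r) * theta r a ^ n * Y).
    { pose proof (pw_pos a (1 - r)). pose proof (pow_lt (theta r a) n (proj1 Hth)).
      assert (0 < pw a (1 - r) * theta r a ^ n * Y) by (repeat apply Rmult_lt_0_compat; lra). lra. }
    pose proof (k1_le_theta r a k (/ (2 - r) * k) Hr Ha Hk ltac:(nra)) as K.
    apply Rle_trans with (theta r a * k1 a k * (B + pw a (1 - r) * theta r a ^ n * Y) + k1 a k * C).
    { apply Rplus_le_compat_r. apply Rmult_le_compat_r; lra. }
    right. rewrite <- HB at 2. simpl. ring.
Qed.

(** One step moves the singularity from 1 to 0. In the branch [f1] the argument 2 - f1 z - c equals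
    f0 z + (1 - c), which is at least f0 z + f0 (T c), the argument of a [Jk] with k = 1 / (2 - r).
    In the branch [f0] the argument is at least 1/2. *)
Lemma PRn_Uk r a : 0 <= r < 1 -> 0 < a < 1 ->
  exists C, 0 < C /\ forall n c x, in01 c -> in01 x -> x <> Nat.iter n (T r) c ->
  PRn r n (Uk a c) x <= C * (1 + theta r a ^ n * pw a (Rabs (x - Nat.iter n (T r) c))).
Proof.
  intros Hr Ha. pose proof (theta_bound r a Hr Ha) as Hth.
  destruct (PRn_Jk r a Hr Ha) as (B & D & HB & HD & H).
  assert (Hi : 0 < / (2 - r)) by (apply Rinv_0_lt_compat; lra).
  set (k := / (2 - r)) in *.
  assert (Hk1 : k1 a k = theta r a) by reflexivity.
  pose proof (pw_pos a (1 / 2)) as Hp.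
  set (E := pw a (1 / 2) * / (1 - r)).
  assert (HE : 0 < E).
  { apply Rmult_lt_0_compat; [auto|apply Rinv_0_lt_compat; lra]. }
  assert (HtB : 0 < theta r a * B) by (apply Rmult_lt_0_compat; lra).
  exists (1 + theta r a * B + D + E). split; [lra|].
  intros n c x Hc Hx Hne. set (Y := pw a (Rabs (x - Nat.iter n (T r) c))).
  assert (HY : 0 < Y) by apply pw_pos.
  destruct n as [|n].
  - simpl in *. unfold Uk.
    assert (pw a (2 - x - c) <= Y); [|nra].
    apply pw_anti; [lra|]. split; [apply Rabs_pos_lt; lra|].
    unfold in01 in *; unfold Rabs; destruct (Rcase_abs _); lra.
  - unfold Y in *; clear Y. rewrite PRn_succ_r. rewrite Nat.iter_succ_r in *.
    set (Y := pw a (Rabs (x - Nat.iter n (T r) (T r c)))) in *.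
    pose proof (T_in01 r c Hr Hc) as Hc'.
    assert (Ht0 : okt r (tau r false 0)) by (apply okt_tau, okt_0; auto).
    eapply Rle_trans.
    { apply PRn_le_split with (c := T r c) (g := Jk a k (tau r false 0) (T r c))
        (C := pw a (1 / 2)); auto; [lra|].
      intros z Hz Hzc. rewrite (PR_branch r true); simpl negb; simpl branch.
      pose proof (f0_range r z Hr Hz). pose proof (f0_range r _ Hr Hc').
      pose proof (f0_T_le_compl r c Hr Hc).
      pose proof (w0_pos r z Hr Hz). pose proof (w0_le_one r z Hr Hz).
      pose proof (okt_den r _ z Hr Ht0 Hz) as Dz.
      pose proof (branch_weight r false 0 z Hr (okt_0 r Hr) Hz) as W.
      simpl branch in W; simpl kfac in W.
      replace (w0 r z / (1 + 0 * f0 r z) ^ 2) with (w0 r z) in W by (field; lra).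
      assert (F : forall y, in01 y -> f0 r y = k * (y / (1 + tau r false 0 * y))).
      { intros y Hy; unfold k; rewrite <- f0_div_den by (auto using okt_0). field; lra. }
      apply Rplus_le_compat.
      - unfold Jk, Uk. rewrite W.
        apply Rmult_le_compat_l; [left; apply div_sq_le; lra|].
        rewrite <- !F by auto. rewrite f1_eq by auto.
        apply pw_anti; [lra|]. split; [|lra].
        assert (0 < z + T r c).
        { unfold in01 in *; destruct (Req_dec z 0), (Req_dec (T r c) 0); lra. }
        rewrite !F by auto. rewrite <- Rmult_plus_distr_l. apply Rmult_lt_0_compat; [auto|].
        pose proof (le_div_den r _ z Hr Ht0 Hz). pose proof (le_div_den r _ _ Hr Ht0 Hc').
        apply Rlt_le_trans with ((1 - r) * (z + T r c)); [nra|lra].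
      - unfold Uk. apply Rle_trans with (1 * pw a (1 / 2)); [|lra].
        apply Rmult_le_compat; try lra; [left; apply pw_pos|].
        apply pw_anti; [lra|]. unfold in01 in *; lra. }
    eapply Rle_trans.
    { apply Rplus_le_compat_r. apply H; auto. }
    fold E. fold Y. rewrite Hk1.
    pose proof (pow_lt (theta r a) n (proj1 Hth)).
    assert (0 < theta r a ^ n * Y) by (apply Rmult_lt_0_compat; lra).
    simpl. replace (theta r a * (B + D * theta r a ^ n * Y) + E) with
      (theta r a * B + E + D * (theta r a * (theta r a ^ n * Y))) by ring.
    rewrite Rmult_assoc.
    assert (0 < theta r a * (theta r a ^ n * Y)) by (apply Rmult_lt_0_compat; lra).
    assert (0 < theta r a * B) by nra.
    nra.
Qed.

Lemma PRn_Gk r a : 0 <= r < 1 -> 0 < a < 1 ->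
  exists B D th, 0 < B /\ 0 < D /\ 0 < th < 1 /\ forall n k t c x, 0 < k -> okt r t -> in01 c ->
  in01 x -> x <> Nat.iter n (T r) c ->
  PRn r n (Gk a k t c) x <=
    k1 a k * (B + D * th ^ n * pw a (Rabs (x - Nat.iter n (T r) c))).
Proof.
  intros Hr Ha. pose proof (theta_bound r a Hr Ha) as Hth.
  destruct (PRn_Uk r a Hr Ha) as (C & HC & HU).
  (* The [Uk] errors born at successive steps decay at the same rate [q] as the main term, which
     could add up to n q^n; a rate [th] strictly above [q] absorbs the factor n. The constants
     satisfy q B + c1 C = B and q D + c1 C <= th D. *)
  set (q := theta r a) in *. set (th := (1 + q) / 2).
  set (c1 := pw a ((1 - r) ^ 2 / 4)). set (c2 := pw a ((1 - r) ^ 2)).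
  assert (Hc1 : 0 < c1) by apply pw_pos. assert (Hc2 : 0 < c2) by apply pw_pos.
  set (B := c1 * C / (1 - q)). set (D := c2 + c1 * C / (th - q)).
  assert (Hthq : q < th < 1) by (unfold th; lra).
  assert (HcC : 0 < c1 * C) by (apply Rmult_lt_0_compat; auto).
  assert (HB : 0 < B) by (apply Rdiv_lt_0_compat; lra).
  assert (HD' : 0 < c1 * C / (th - q)) by (apply Rdiv_lt_0_compat; lra).
  assert (HD : 0 < D) by (unfold D; lra).
  exists B, D, th. split; [auto|]. split; [auto|]. split; [lra|].
  induction n as [|n IH]; intros k t c x Hk Ht Hc Hx Hne.
  - simpl in Hne |- *. unfold Gk.
    pose proof (okt_den r t x Hr Ht Hx) as Dx. pose proof (okt_den r t c Hr Ht Hc) as Dc.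
    pose proof (div_sq_le k (1 + t * x) Hk (proj1 Dx)).
    assert (0 < Rabs (x - c)) by (apply Rabs_pos_lt; lra).
    pose proof (k1_pos a k Hk) as Hk1.
    apply Rle_trans with (k * (pw a k * (c2 * pw a (Rabs (x - c))))).
    + apply Rmult_le_compat; try lra; [left; apply pw_pos|].
      unfold c2; rewrite <- (pw_mult a ((1 - r) ^ 2)) by nra.
      rewrite <- pw_mult by (auto; apply Rmult_lt_0_compat; nra). apply pw_anti; [lra|].
      split; [repeat apply Rmult_lt_0_compat; nra|].
      unfold Rdiv. rewrite Rmult_assoc. apply Rmult_le_compat_l; [lra|].
      rewrite Rmult_comm. apply Rmult_le_compat_l; [lra|].
      apply Rmult_le_reg_r with ((1 + t * x) * (1 + t * c)); [nra|].
      rewrite Rinv_l by nra.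
      replace ((1 - r) ^ 2 * ((1 + t * x) * (1 + t * c))) with
       (((1 - r) * (1 + t * x)) * ((1 - r) * (1 + t * c))) by ring.
      rewrite <- (Rmult_1_l 1) at 5. apply Rmult_le_compat; nra.
    + unfold k1 in *. pose proof (pw_pos a (Rabs (x - c))).
      replace (k * (pw a k * (c2 * pw a (Rabs (x - c))))) with
        (k * pw a k * (c2 * pw a (Rabs (x - c)))) by ring.
      apply Rmult_le_compat_l; [lra|]. unfold D; nra.
  - rewrite PRn_succ_r. rewrite Nat.iter_succ_r in Hne |- *.
    pose proof (k1_pos a k Hk) as Hk1.
    destruct (PR_Gk r a k t c Hr Ha Hk Ht Hc) as (k' & t' & Hk' & Ht' & HG).
    pose proof (T_in01 r c Hr Hc) as Hc'.
    apply Rle_trans with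
      (PRn r n (fun z => 1 * Gk a k' t' (T r c) z + k1 a k * c1 * Uk a (T r c) z) x).
    { apply PRn_le_avoid with (T r c); auto. intros z Hz Hzc; rewrite Rmult_1_l; apply HG; auto. }
    rewrite PRn_lin, Rmult_1_l.
    specialize (IH k' t' (T r c) x (proj1 Hk') Ht' Hc' Hx Hne).
    specialize (HU n (T r c) x Hc' Hx Hne).
    set (Y := pw a (Rabs (x - Nat.iter n (T r) (T r c)))) in *.
    assert (HY : 0 < Y) by apply pw_pos.
    pose proof (k1_le_theta r a k k' Hr Ha Hk Hk') as K. fold q in K.
    assert (Hq : 0 < q ^ n) by (apply pow_lt; lra).
    assert (Hqt : q ^ n <= th ^ n) by (apply pow_incr; lra).
    apply Rle_trans with (q * k1 a k * (B + D * th ^ n * Y) + k1 a k * c1 * (C * (1 + th ^ n * Y))).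
    { apply Rplus_le_compat.
      - eapply Rle_trans; [apply IH|]. apply Rmult_le_compat_r; [|lra].
        assert (0 < D * th ^ n * Y) by (repeat apply Rmult_lt_0_compat; lra). lra.
      - apply Rmult_le_compat_l; [nra|].
        eapply Rle_trans; [apply HU|]. apply Rmult_le_compat_l; [lra|].
        apply Rplus_le_compat_l, Rmult_le_compat_r; lra. }
    apply Rle_trans with (k1 a k * ((q * B + c1 * C) + (q * D + c1 * C) * (th ^ n * Y))).
    { right; ring. }
    apply Rmult_le_compat_l; [lra|]. apply Rplus_le_compat.
    { right; unfold B; field; lra. }
    replace (D * th ^ S n * Y) with (D * th * (th ^ n * Y)) by (simpl; ring).
    apply Rmult_le_compat_r.
    { left; apply Rmult_lt_0_compat; lra. }
    assert (c1 * C = (c1 * C / (th - q)) * (th - q)) by (field; lra).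
    unfold D in *. nra.
Qed.

Lemma PRn_pole r a b : 0 <= r < 1 -> 0 < a < 1 -> in01 b ->
  exists C th, 0 < C /\ 0 < th < 1 /\ forall n x, in01 x -> x <> Nat.iter n (T r) b ->
  PRn r n (fun y => pw a (Rabs (y - b))) x <=
    C * (1 + th ^ n * pw a (Rabs (x - Nat.iter n (T r) b))).
Proof.
  intros Hr Ha Hb. destruct (PRn_Gk r a Hr Ha) as (B & D & th & HB & HD & Hth & H).
  exists (B + D), th. split; [lra|]. split; [auto|]. intros n x Hx Hne.
  specialize (H n 1 0 b x Rlt_0_1 (okt_0 r Hr) Hb Hx Hne).
  replace (k1 a 1) with 1 in H by (rewrite k1_eq by lra; unfold Rpower; rewrite ln_1, Rmult_0_r, exp_0; auto).
  eapply Rle_trans; [|eapply Rle_trans; [apply H|]].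
  - right; apply PRn_ext; auto. intros z Hz; unfold Gk.
    replace (1 * Rabs (z - b) / ((1 + 0 * z) * (1 + 0 * b))) with (Rabs (z - b)) by (field; lra).
    field; lra.
  - set (Y := pw a (Rabs (x - Nat.iter n (T r) b))).
    assert (0 < Y) by apply pw_pos. pose proof (pow_lt th n (proj1 Hth)).
    assert (0 < th ^ n * Y) by (apply Rmult_lt_0_compat; lra). nra.
Qed.

(** * Words of inverse branches and functions of bounded variation *)

(* The head of a word is applied first, so [Fw r (j :: u) = Fw r u o f_{r,j}]. *)
Fixpoint Fw (r : R) (w : list bool) (x : R) : R :=
  match w with nil => x | j :: u => Fw r u (branch r j x) end.
Fixpoint tw (r : R) (w : list bool) : R :=
  match w with nil => 0 | j :: u => tau r j (tw r u) end.
Fixpoint kw (r : R) (w : list bool) : R :=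
  match w with nil => 1 | j :: u => kfac r j (tw r u) * kw r u end.
Fixpoint sw (w : list bool) : R :=
  match w with nil => 1 | j :: u => sgb j * sw u end.
Fixpoint sumw (n : nat) (F : list bool -> R) : R :=
  match n with O => F nil | S m => sumw m (fun w => F (false :: w) + F (true :: w)) end.

Lemma okt_tw r w : 0 <= r < 1 -> okt r (tw r w).
Proof. intros; induction w; simpl; auto using okt_0, okt_tau. Qed.

Lemma kw_bound r w : 0 <= r < 1 -> 0 < kw r w <= (/ (2 - r)) ^ length w.
Proof.
  intros Hr; induction w as [|j u IH]; simpl; [lra|].
  pose proof (kfac_bound r j _ Hr (proj1 (okt_tw r u Hr))).
  split; [apply Rmult_lt_0_compat; lra|]. apply Rmult_le_compat; lra.
Qed.

Lemma sw_cases w : sw w = 1 \/ sw w = -1.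
Proof.
  induction w as [|j u [E|E]]; simpl; auto; rewrite E; destruct j; simpl; lra.
Qed.

Lemma Fw_in01 r w x : 0 <= r < 1 -> in01 x -> in01 (Fw r w x).
Proof. intros Hr; revert x; induction w; simpl; auto using branch_in01. Qed.

Lemma Fw_diff r w x y : 0 <= r < 1 -> in01 x -> in01 y ->
  Fw r w x - Fw r w y =
  sw w * kw r w * (x - y) / ((1 + tw r w * x) * (1 + tw r w * y)).
Proof.
  intros Hr; revert x y; induction w as [|j u IH]; intros x y Hx Hy.
  - simpl; field; lra.
  - cbn [Fw]. rewrite IH by auto using branch_in01.
    unfold Rdiv; rewrite Rmult_assoc.
    change (sw u * kw r u * ((branch r j x - branch r j y) /
       ((1 + tw r u * branch r j x) * (1 + tw r u * branch r j y))) =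
       sw (j :: u) * kw r (j :: u) * (x - y) *
       / ((1 + tw r (j :: u) * x) * (1 + tw r (j :: u) * y))).
    rewrite branch_diff by auto using okt_tw. simpl. unfold Rdiv; ring.
Qed.

Lemma sumw_le n F G : (forall w, length w = n -> F w <= G w) -> sumw n F <= sumw n G.
Proof.
  revert F G; induction n; intros F G H; simpl; [apply H; auto|].
  apply IHn; intros w Hw; apply Rplus_le_compat; apply H; simpl; auto.
Qed.

Lemma sumw_ext n F G : (forall w, length w = n -> F w = G w) -> sumw n F = sumw n G.
Proof. intros H; apply Rle_antisym; apply sumw_le; intros w Hw; rewrite H; auto; lra. Qed.

Lemma sumw_lin n a b F G : sumw n (fun w => a * F w + b * G w) = a * sumw n F + b * sumw n G.
Proof.
  revert F G; induction n; intros F G; simpl; [reflexivity|].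
  rewrite <- IHn. apply sumw_ext; intros; ring.
Qed.

Lemma sumw_scal n a F : sumw n (fun w => a * F w) = a * sumw n F.
Proof.
  revert F; induction n; intros F; simpl; [reflexivity|].
  rewrite <- IHn. apply sumw_ext; intros; ring.
Qed.

Lemma sumw_dist n F G H : (forall w, length w = n -> Rabs (F w - G w) <= H w) ->
  Rabs (sumw n F - sumw n G) <= sumw n H.
Proof.
  intros Hd. replace (sumw n F - sumw n G) with (1 * sumw n F + (-1) * sumw n G) by ring.
  rewrite <- sumw_lin. apply Rabs_le; split.
  - replace (- sumw n H) with ((-1) * sumw n H) by ring. rewrite <- sumw_scal.
    apply sumw_le; intros w Hw; specialize (Hd w Hw). apply Rabs_le_between in Hd; lra.
  - apply sumw_le; intros w Hw; specialize (Hd w Hw). apply Rabs_le_between in Hd; lra.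
Qed.

Lemma PRn_sumw r n f x : 0 <= r < 1 -> in01 x ->
  PRn r n f x = sumw n (fun w => kw r w / (1 + tw r w * x) ^ 2 * f (Fw r w x)).
Proof.
  intros Hr; revert x; induction n; intros x Hx.
  - cbn [sumw PRn kw tw Fw]. replace (1 + 0 * x) with 1 by ring. field.
  - cbn [PRn]. unfold PR. rewrite !IHn by auto using f0_in01, f1_in01.
    rewrite Rmult_plus_distr_l, <- sumw_lin. cbn [sumw]. apply sumw_ext. intros w Hw.
    pose proof (branch_weight r false _ x Hr (okt_tw r w Hr) Hx) as W0.
    pose proof (branch_weight r true _ x Hr (okt_tw r w Hr) Hx) as W1.
    cbn [tw kw Fw branch] in *. unfold Rdiv in *. f_equal.
    + rewrite <- Rmult_assoc. f_equal.
      transitivity (kw r w * (w0 r x * / (1 + tw r w * f0 r x) ^ 2)); [ring|]. rewrite W0; ring.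
    + rewrite <- Rmult_assoc. f_equal.
      transitivity (kw r w * (w0 r x * / (1 + tw r w * f1 r x) ^ 2)); [ring|]. rewrite W1; ring.
Qed.

(** Increment of [g] over the image of [0, 1] under [Fw r w], the sign correcting the orientation:
    the length of this cylinder if [g] is the identity, the integral of [f] over it if [g] is a
    primitive of [f]. *)
Definition dw (r : R) (g : R -> R) (w : list bool) : R :=
  sw w * (g (Fw r w 1) - g (Fw r w 0)).

(** The cylinders of one generation tile [0, 1]: [f0] and [f1] agree at 1 and send 0 to the two
    ends, so interior terms cancel. *)
Lemma sumw_dw r n g : 0 <= r < 1 -> sumw n (dw r g) = g 1 - g 0.
Proof.
  intros Hr; induction n; [unfold dw; simpl; ring|].
  rewrite <- IHn. cbn [sumw]. apply sumw_ext. intros w _. unfold dw. cbn [Fw branch sw sgb].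
  replace (f0 r 0) with 0 by (unfold f0; field; lra).
  replace (f1 r 0) with 1 by (unfold f1; field; lra).
  replace (f1 r 1) with (f0 r 1) by (unfold f0, f1; field; lra). ring.
Qed.

(** Bounded variation given by a dominating function instead of a number: the variation over a
    cylinder becomes an increment of [g], and these add up by [sumw_dw]. *)
Definition bvdom (a b : R) (f g : R -> R) : Prop :=
  forall x y, a <= x -> x <= y -> y <= b -> Rabs (f y - f x) <= g y - g x.

Lemma bvdom_mono a b f g x y : bvdom a b f g -> a <= x -> x <= y -> y <= b -> g x <= g y.
Proof. intros H Ha Hxy Hb; pose proof (H x y Ha Hxy Hb); pose proof (Rabs_pos (f y - f x)); lra. Qed.

Lemma bvdom_RInt_approx f g a b z : bvdom 0 1 f g -> ex_RInt f 0 1 -> 0 <= a -> b <= 1 ->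
  a <= z <= b -> Rabs (RInt f a b - (b - a) * f z) <= (b - a) * (g b - g a).
Proof.
  intros Hd Hi Ha Hb Hz.
  assert (Hab : ex_RInt f a b).
  { apply (ex_RInt_Chasles_2 f 0 a b); [lra|]. apply (ex_RInt_Chasles_1 f 0 b 1); [lra|auto]. }
  assert (E : RInt f a b - (b - a) * f z = RInt (fun x => f x - f z) a b).
  { symmetry; apply is_RInt_unique.
    apply (is_RInt_minus f (fun _ => f z) a b (RInt f a b) ((b - a) * f z)).
    - apply (RInt_correct f a b); auto.
    - apply (is_RInt_const a b (f z)). }
  rewrite E. apply abs_RInt_le_const; [lra| |].
  - apply (ex_RInt_minus f (fun _ => f z)); auto. apply ex_RInt_const.
  - intros t Ht. destruct (Rle_dec t z).
    + rewrite Rabs_minus_sym. pose proof (Hd t z ltac:(lra) ltac:(lra) ltac:(lra)).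
      pose proof (bvdom_mono 0 1 f g a t Hd). pose proof (bvdom_mono 0 1 f g z b Hd). lra.
    + pose proof (Hd z t ltac:(lra) ltac:(lra) ltac:(lra)).
      pose proof (bvdom_mono 0 1 f g a z Hd). pose proof (bvdom_mono 0 1 f g t b Hd). lra.
Qed.

Lemma dw_id r w : 0 <= r < 1 -> dw r (fun x => x) w = kw r w / (1 + tw r w).
Proof.
  intros Hr; unfold dw. assert (in01 0 /\ in01 1) as [H0 H1] by (unfold in01; lra).
  rewrite Fw_diff by auto. destruct (okt_tw r w Hr) as [Ht _].
  destruct (sw_cases w) as [-> | ->]; field; lra.
Qed.

Lemma RInt_prefix_diff (f : R -> R) a b : ex_RInt f 0 1 -> 0 <= a <= b -> b <= 1 ->
  RInt f 0 b - RInt f 0 a = RInt f a b.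
Proof.
  intros Hi Ha Hb.
  assert (H0b : ex_RInt f 0 b) by (apply (ex_RInt_Chasles_1 f 0 b 1); auto; lra).
  assert (H0a : ex_RInt f 0 a) by (apply (ex_RInt_Chasles_1 f 0 a b); auto; lra).
  assert (Hab : ex_RInt f a b) by (apply (ex_RInt_Chasles_2 f 0 a b); auto; lra).
  pose proof (RInt_Chasles f 0 a b H0a Hab) as E. unfold plus in E; simpl in E. lra.
Qed.

Lemma dw_RInt_approx r f g w x : 0 <= r < 1 -> bvdom 0 1 f g -> ex_RInt f 0 1 -> in01 x ->
  Rabs (dw r (RInt f 0) w - dw r (fun y => y) w * f (Fw r w x)) <=
  dw r (fun y => y) w * dw r g w.
Proof.
  intros Hr Hd Hi Hx. assert (in01 0 /\ in01 1) as [H0 H1] by (unfold in01; lra).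
  pose proof (Fw_in01 r w 0 Hr H0) as Ra. pose proof (Fw_in01 r w 1 Hr H1) as Rb.
  pose proof (Fw_diff r w x 0 Hr Hx H0) as E0. pose proof (Fw_diff r w 1 x Hr H1 Hx) as E1.
  pose proof (okt_den r _ x Hr (okt_tw r w Hr) Hx) as Dx.
  pose proof (okt_den r _ 1 Hr (okt_tw r w Hr) H1) as D1.
  pose proof (kw_bound r w Hr) as Hk.
  set (a := Fw r w 0) in *. set (b := Fw r w 1) in *. set (z := Fw r w x) in *.
  set (t := tw r w) in *.
  assert (Q0 : 0 <= kw r w * (x - 0) / ((1 + t * x) * (1 + t * 0))).
  { unfold in01 in *. apply Rdiv_le_0_compat; nra. }
  assert (Q1 : 0 <= kw r w * (1 - x) / ((1 + t * 1) * (1 + t * x))).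
  { unfold in01 in *. apply Rdiv_le_0_compat; nra. }
  unfold dw; fold a b. unfold in01 in *.
  destruct (sw_cases w) as [S|S]; rewrite S in *.
  - replace (1 * kw r w * (x - 0) / ((1 + t * x) * (1 + t * 0))) with
     (kw r w * (x - 0) / ((1 + t * x) * (1 + t * 0))) in E0 by (unfold Rdiv; ring).
    replace (1 * kw r w * (1 - x) / ((1 + t * 1) * (1 + t * x))) with
     (kw r w * (1 - x) / ((1 + t * 1) * (1 + t * x))) in E1 by (unfold Rdiv; ring).
    rewrite !Rmult_1_l, (RInt_prefix_diff f a b) by (auto; lra).
    apply bvdom_RInt_approx; auto; lra.
  - replace (-1 * kw r w * (x - 0) / ((1 + t * x) * (1 + t * 0))) with
     (- (kw r w * (x - 0) / ((1 + t * x) * (1 + t * 0)))) in E0 by (unfold Rdiv; ring).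
    replace (-1 * kw r w * (1 - x) / ((1 + t * 1) * (1 + t * x))) with
     (- (kw r w * (1 - x) / ((1 + t * 1) * (1 + t * x)))) in E1 by (unfold Rdiv; ring).
    replace (-1 * (RInt f 0 b - RInt f 0 a)) with (RInt f 0 a - RInt f 0 b) by ring.
    replace (-1 * (b - a)) with (a - b) by ring. replace (-1 * (g b - g a)) with (g a - g b) by ring.
    rewrite (RInt_prefix_diff f b a) by (auto; lra).
    apply bvdom_RInt_approx; auto; lra.
Qed.

(* Normalised derivative of a Moebius branch: the span of these functions is
   invariant under the transfer operator, which acts on it as a Markov chain
   on the parameter [t] that contracts the Lipschitz constant. *)
Definition gmob (t x : R) : R := (1 + t) / (1 + t * x) ^ 2.

Lemma bvdom_bound f g x : bvdom 0 1 f g -> in01 x -> Rabs (f x) <= Rabs (f 0) + (g 1 - g 0).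
Proof.
  unfold in01; intros H Hx. pose proof (H 0 x ltac:(lra) ltac:(lra) ltac:(lra)).
  pose proof (bvdom_mono 0 1 f g x 1 H).
  replace (f x) with ((f x - f 0) + f 0) by ring.
  eapply Rle_trans; [apply Rabs_triang|]. lra.
Qed.

(** In each term of [PRn_sumw], cylinder length times a value of [f] is replaced by the integral of
    [f] over the cylinder. This costs at most (2-r)^(-n) times the increment of [g] there, and the
    increments sum to [g 1 - g 0]. *)
Lemma PRn_gmob_approx r n f g x : 0 <= r < 1 -> bvdom 0 1 f g -> ex_RInt f 0 1 -> in01 x ->
  Rabs (PRn r n f x - sumw n (fun w => dw r (RInt f 0) w * gmob (tw r w) x)) <=
  (/ (2 - r)) ^ n * (g 1 - g 0).
Proof.
  intros Hr Hd Hi Hx. rewrite PRn_sumw, <- (sumw_dw r n g Hr), <- sumw_scal by auto.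
  apply sumw_dist. intros w Hw.
  pose proof (dw_RInt_approx r f g w x Hr Hd Hi Hx) as A. rewrite dw_id in A by auto.
  pose proof (okt_den r _ x Hr (okt_tw r w Hr) Hx) as Dx.
  destruct (okt_tw r w Hr) as [Ht _].
  pose proof (kw_bound r w Hr) as Hk. rewrite Hw in Hk.
  set (t := tw r w) in *. set (I := dw r (RInt f 0) w) in *. set (V := dw r g w) in *.
  set (y := f (Fw r w x)) in *.
  (* Read off from [A]: an absolute value is at most a positive length times [V]. *)
  assert (HV : 0 <= V).
  { assert (0 < kw r w / (1 + t)) by (apply Rdiv_lt_0_compat; lra).
    pose proof (Rabs_pos (I - kw r w / (1 + t) * y)). nra. }
  assert (Hg : 0 < gmob t x) by (apply Rdiv_lt_0_compat; nra).
  replace (kw r w / (1 + t * x) ^ 2 * y - I * gmob t x) with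
    (- (gmob t x * (I - kw r w / (1 + t) * y))) by (unfold gmob; field; lra).
  rewrite Rabs_Ropp, Rabs_mult, (Rabs_pos_eq (gmob t x)) by lra.
  apply Rle_trans with (gmob t x * (kw r w / (1 + t) * V)).
  { apply Rmult_le_compat_l; lra. }
  replace (gmob t x * (kw r w / (1 + t) * V)) with (kw r w / (1 + t * x) ^ 2 * V)
    by (unfold gmob; field; lra).
  apply Rmult_le_compat_r; auto.
  pose proof (div_sq_le (kw r w) (1 + t * x) (proj1 Hk) (proj1 Dx)). lra.
Qed.

Lemma sumw_dw_RInt_abs r n f g M : 0 <= r < 1 -> bvdom 0 1 f g -> ex_RInt f 0 1 ->
  (forall x, in01 x -> Rabs (f x) <= M) ->
  sumw n (fun w => Rabs (dw r (RInt f 0) w)) <= M.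
Proof.
  intros Hr Hd Hi HM. replace M with (M * (1 - 0)) by ring.
  rewrite <- (sumw_dw r n (fun x => x) Hr), <- sumw_scal. apply sumw_le. intros w _.
  assert (in01 0 /\ in01 1) as [H0 H1] by (unfold in01; lra).
  pose proof (Fw_in01 r w 0 Hr H0) as Ra. pose proof (Fw_in01 r w 1 Hr H1) as Rb.
  pose proof (dw_id r w Hr) as E. pose proof (kw_bound r w Hr) as Hk.
  destruct (okt_tw r w Hr) as [Ht _].
  assert (P : 0 < dw r (fun x => x) w) by (rewrite E; apply Rdiv_lt_0_compat; lra).
  clear E. revert P. unfold dw. set (a := Fw r w 0) in *. set (b := Fw r w 1) in *.
  unfold in01 in *.
  assert (B : forall a b, 0 <= a <= b -> b <= 1 -> Rabs (RInt f 0 b - RInt f 0 a) <= (b - a) * M).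
  { intros a' b' Ha' Hb'. rewrite (RInt_prefix_diff f a' b') by auto.
    apply abs_RInt_le_const; [lra| |intros; apply HM; lra].
    apply (ex_RInt_Chasles_2 f 0 a' b'); [lra|]. apply (ex_RInt_Chasles_1 f 0 b' 1); [lra|auto]. }
  destruct (sw_cases w) as [-> | ->]; intros P.
  - specialize (B a b). rewrite !Rmult_1_l, Rmult_comm. apply B; lra.
  - specialize (B b a). rewrite Rabs_mult, Rabs_minus_sym, (Rabs_left (-1)) by lra.
    replace (M * (-1 * (b - a))) with ((a - b) * M) by ring. replace (- -1) with 1 by ring. rewrite Rmult_1_l.
    apply B; lra.
Qed.

(** * Contraction of the Markov chain on the parameter *)

Lemma PRn_sumw_comm r k n (H : list bool -> R -> R) x :
  PRn r k (fun z => sumw n (fun w => H w z)) x = sumw n (fun w => PRn r k (H w) x).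
Proof.
  revert H; induction n; intros H; simpl; [reflexivity|].
  rewrite (IHn (fun w z => H (false :: w) z + H (true :: w) z)). apply sumw_ext; intros w _.
  pose proof (PRn_lin r k 1 1 (H (false :: w)) (H (true :: w)) x) as E.
  rewrite !Rmult_1_l in E. rewrite <- E.
  clear. revert x; induction k; intros x; simpl; [ring|].
  unfold PR; rewrite !IHk; reflexivity.
Qed.

(** The weights are the masses that the density [gmob t] gives to [0, 1/2] and [1/2, 1], and they
    sum to 1. *)
Lemma PR_gmob r t x : 0 <= r < 1 -> okt r t -> in01 x ->
  PR r (gmob t) x = (1 + t) / (2 + t) * gmob (tau r false t) x + / (2 + t) * gmob (tau r true t) x.
Proof.
  intros Hr Ht Hx.
  pose proof (branch_weight r false _ x Hr Ht Hx) as W0.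
  pose proof (branch_weight r true _ x Hr Ht Hx) as W1.
  pose proof (tau_den_pos r false t x Hr Ht Hx) as D0.
  pose proof (tau_den_pos r true t x Hr Ht Hx) as D1.
  destruct Ht as [Ht _]. rewrite (PR_branch r false). unfold gmob.
  replace (w0 r x * ((1 + t) / (1 + t * branch r false x) ^ 2)) with
    ((1 + t) * (w0 r x / (1 + t * branch r false x) ^ 2)) by (unfold Rdiv; ring).
  simpl negb.
  replace (w0 r x * ((1 + t) / (1 + t * branch r true x) ^ 2)) with
    ((1 + t) * (w0 r x / (1 + t * branch r true x) ^ 2)) by (unfold Rdiv; ring).
  rewrite W0, W1. unfold Rdiv.
  replace (1 + tau r false t) with ((2 + t) / (2 - r)) by (simpl; field; lra).
  replace (1 + tau r true t) with ((2 + t) / ((2 - r) * (1 + t))) by (simpl; field; lra).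
  revert D0 D1; generalize (1 + tau r false t * x) (1 + tau r true t * x); intros u v D0 D1.
  unfold kfac; field; repeat split; lra.
Qed.

Lemma gmob_lip r t t' x : 0 <= r < 1 -> okt r t -> okt r t' -> in01 x ->
  Rabs (gmob t x - gmob t' x) <= (/ (1 - r)) ^ 2 * Rabs (t - t').
Proof.
  intros Hr Ht Ht' Hx.
  pose proof (okt_den r _ x Hr Ht Hx) as D. pose proof (okt_den r _ x Hr Ht' Hx) as D'.
  destruct Ht as [Ht Hb], Ht' as [Ht' Hb'].
  replace (gmob t x - gmob t' x) with
    ((1 - 2 * x - x ^ 2 * (t + t') - x ^ 2 * (t * t')) / ((1 + t * x) ^ 2 * (1 + t' * x) ^ 2) * (t - t'))
    by (unfold gmob; field; lra).
  rewrite Rabs_mult. apply Rmult_le_compat_r; [apply Rabs_pos|].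
  assert (1 <= (1 + t * x) ^ 2 * (1 + t' * x) ^ 2).
  { rewrite <- (Rmult_1_l 1) at 1. apply Rmult_le_compat; try lra; nra. }
  unfold Rdiv; rewrite Rabs_mult, Rabs_inv, (Rabs_pos_eq (_ * _)) by lra.
  assert (I1 : 0 < / (1 - r)) by (apply Rinv_0_lt_compat; lra).
  assert (B : forall s, (1 - r) * (1 + s) <= 1 -> 1 + s <= / (1 - r)).
  { intros s Hs. apply Rmult_le_reg_l with (1 - r); [lra|]. rewrite Rinv_r; lra. }
  pose proof (B _ Hb) as Bt. pose proof (B _ Hb') as Bt'.
  apply Rle_trans with ((1 + t) * (1 + t')).
  - rewrite <- (Rmult_1_r ((1 + t) * (1 + t'))).
    apply Rmult_le_compat; [apply Rabs_pos | left; apply Rinv_0_lt_compat; lra | |].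
    + unfold in01 in Hx. assert (0 <= x ^ 2 <= 1) by nra.
      assert (0 <= t * t') by nra.
      assert (0 <= x ^ 2 * (t + t') <= t + t') by (split; [apply Rmult_le_pos; lra | nra]).
      assert (0 <= x ^ 2 * (t * t') <= t * t') by (split; [apply Rmult_le_pos; lra | nra]).
      apply Rabs_le. nra.
    + rewrite <- Rinv_1 at 3. apply Rinv_le_contravar; lra.
  - simpl. rewrite Rmult_1_r. apply Rmult_le_compat; lra.
Qed.

(** The left side is the expected distance after one step of a coupling of the chains started at [t]
    and [t']: both take [f0] with probability (1+t)/(2+t), both take [f1] with probability 1/(2+t'),
    and otherwise the chain from [t'] takes [f0] while the one from [t] takes [f1]. *)
Lemma tau_coupling r t t' : 0 <= r < 1 -> 0 <= t <= t' ->
  (1 + t) / (2 + t) * (tau r false t' - tau r false t)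
  + / (2 + t') * (tau r true t - tau r true t')
  + ((1 + t') / (2 + t') - (1 + t) / (2 + t)) * (tau r false t' - tau r true t)
  <= / (2 - r) * (t' - t).
Proof.
  intros Hr Ht. unfold tau.
  set (a := 1 + t). set (b := 1 + t').
  replace (2 + t) with (1 + a) by (unfold a; ring). replace (2 + t') with (1 + b) by (unfold b; ring).
  replace (t + r) with (a - 1 + r) by (unfold a; ring).
  replace (t' + r) with (b - 1 + r) by (unfold b; ring).
  replace (t' - t) with (b - a) by (unfold a, b; ring).
  assert (Ha : 1 <= a) by (unfold a; lra). assert (Hab : a <= b) by (unfold a, b; lra).
  clearbody a b.
  match goal with |- ?L <= ?R => assert (E : R - L =
    / (2 - r) * (b - a) * ((a * b + b - a - 1) / ((1 + a) * (1 + b) * a * b))) end.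
  { field. lra. }
  match goal with |- ?L <= ?R => assert (0 <= R - L); [rewrite E|lra] end.
  apply Rmult_le_pos.
  - apply Rmult_le_pos; [left; apply Rinv_0_lt_compat|]; lra.
  - apply Rdiv_le_0_compat; [nra|repeat apply Rmult_lt_0_compat; lra].
Qed.

(** Fixes the signs of the three differences in [tau_coupling], so that they are distances. *)
Lemma tau_order r t t' : 0 <= r < 1 -> 0 <= t <= t' ->
  tau r false t <= tau r false t' /\ tau r true t' <= tau r true t /\ tau r true t <= tau r false t'.
Proof.
  intros Hr Ht. assert (0 < / (2 - r)) by (apply Rinv_0_lt_compat; lra).
  assert (/ (1 + t') <= / (1 + t)) by (apply Rinv_le_contravar; lra).
  assert (/ (1 + t) <= 1) by (rewrite <- Rinv_1 at 2; apply Rinv_le_contravar; lra).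
  simpl; unfold Rdiv; repeat split; apply Rmult_le_compat_r; lra.
Qed.

Lemma PRn_gmob_lip r k t t' x : 0 <= r < 1 -> okt r t -> okt r t' -> in01 x ->
  Rabs (PRn r k (gmob t) x - PRn r k (gmob t') x) <=
  (/ (2 - r)) ^ k * (/ (1 - r)) ^ 2 * Rabs (t - t').
Proof.
  intros Hr Ht Ht' Hx. revert t t' Ht Ht'. induction k as [|k IH]; intros t t'.
  { simpl pow at 1. rewrite Rmult_1_l. intros; apply gmob_lip; auto. }
  assert (W : forall t t', okt r t -> okt r t' -> t <= t' ->
    Rabs (PRn r (S k) (gmob t') x - PRn r (S k) (gmob t) x) <=
    (/ (2 - r)) ^ S k * (/ (1 - r)) ^ 2 * (t' - t)).
  { clear t t'; intros t t' Ht Ht' Htt.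
    assert (E : forall t, okt r t -> PRn r (S k) (gmob t) x =
      (1 + t) / (2 + t) * PRn r k (gmob (tau r false t)) x + / (2 + t) * PRn r k (gmob (tau r true t)) x).
    { intros s Hs. rewrite PRn_succ_r, <- PRn_lin. apply PRn_ext; auto.
      intros z Hz; apply PR_gmob; auto. }
    rewrite !E by auto.
    pose proof (IH _ _ (okt_tau r false t' Hr Ht') (okt_tau r false t Hr Ht)) as A1.
    pose proof (IH _ _ (okt_tau r true t' Hr Ht') (okt_tau r true t Hr Ht)) as A2.
    pose proof (IH _ _ (okt_tau r false t' Hr Ht') (okt_tau r true t Hr Ht)) as A3.
    destruct Ht as [Ht _], Ht' as [Ht' _].
    destruct (tau_order r t t' Hr (conj Ht Htt)) as (O1 & O2 & O3).
    pose proof (tau_coupling r t t' Hr (conj Ht Htt)) as C.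
    rewrite (Rabs_pos_eq (tau r false t' - _)) in A1 by lra.
    rewrite (Rabs_left1 (tau r true t' - _)) in A2 by lra.
    rewrite (Rabs_pos_eq (tau r false t' - _)) in A3 by lra.
    set (Q := (/ (2 - r)) ^ k * (/ (1 - r)) ^ 2) in *.
    assert (HQ : 0 < Q).
    { apply Rmult_lt_0_compat; apply pow_lt; apply Rinv_0_lt_compat; lra. }
    replace ((/ (2 - r)) ^ S k * (/ (1 - r)) ^ 2) with (Q * / (2 - r)) by (unfold Q; simpl; ring).
    set (F := PRn r k) in *.
    assert (P0 : 0 <= (1 + t) / (2 + t)) by (apply Rdiv_le_0_compat; lra).
    assert (P1 : 0 <= / (2 + t')) by (left; apply Rinv_0_lt_compat; lra).
    assert (P2 : 0 <= (1 + t') / (2 + t') - (1 + t) / (2 + t)).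
    { replace ((1 + t') / (2 + t') - (1 + t) / (2 + t)) with ((t' - t) / ((2 + t) * (2 + t'))) by (field; lra).
      apply Rdiv_le_0_compat; nra. }
    (* Splits the weight of [f1] at [t] into the part matched with [f1] at [t'] and the mismatched
       part. *)
    replace (/ (2 + t)) with (/ (2 + t') + ((1 + t') / (2 + t') - (1 + t) / (2 + t))) by (field; lra).
    set (p0 := (1 + t) / (2 + t)) in *. set (p1 := / (2 + t')) in *.
    set (p0' := (1 + t') / (2 + t')) in *.
    set (X1 := F (gmob (tau r false t')) x) in *. set (X2 := F (gmob (tau r false t)) x) in *.
    set (Y1 := F (gmob (tau r true t')) x) in *. set (Y2 := F (gmob (tau r true t)) x) in *.
    replace (p0' * X1 + p1 * Y1 - (p0 * X2 + (p1 + (p0' - p0)) * Y2)) with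
      (p0 * (X1 - X2) + p1 * (Y1 - Y2) + (p0' - p0) * (X1 - Y2)) by ring.
    eapply Rle_trans; [apply Rabs_triang|].
    eapply Rle_trans; [apply Rplus_le_compat_r; apply Rabs_triang|].
    rewrite !Rabs_mult, (Rabs_pos_eq p0), (Rabs_pos_eq p1), (Rabs_pos_eq (p0' - p0)) by lra.
    apply Rle_trans with (p0 * (Q * (tau r false t' - tau r false t))
      + p1 * (Q * - (tau r true t' - tau r true t)) + (p0' - p0) * (Q * (tau r false t' - tau r true t))).
    { repeat apply Rplus_le_compat; apply Rmult_le_compat_l; lra. }
    rewrite Rmult_assoc. eapply Rle_trans; [|apply Rmult_le_compat_l; [lra|apply C]].
    right; ring. }
  intros Ht Ht'. destruct (Rle_dec t t') as [L|L].
  - rewrite (Rabs_minus_sym t), Rabs_minus_sym, (Rabs_pos_eq (t' - t)) by lra. apply W; auto.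
  - rewrite (Rabs_pos_eq (t - t')) by lra. apply W; auto; lra.
Qed.

(** The first [n] applications turn [f] into a mixture whose weights sum to its integral; the next
    [k] make the chain forget its parameter, so each density may be replaced by [gmob 0], the
    constant 1. Of the three factors 1 / (1 - r), two come from [gmob_lip] and one from the bound on
    t. *)
Lemma PRn_bv_approx r f g M : 0 <= r < 1 -> bvdom 0 1 f g -> ex_RInt f 0 1 ->
  (forall x, in01 x -> Rabs (f x) <= M) ->
  forall k n x, in01 x ->
  Rabs (PRn r (k + n) f x - RInt f 0 1 * PRn r k (fun _ => 1) x) <=
  (/ (2 - r)) ^ n * (g 1 - g 0) * / (1 - r) + (/ (2 - r)) ^ k * (/ (1 - r)) ^ 3 * M.
Proof.
  intros Hr Hd Hi HM k n x Hx. rewrite PRn_add.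
  set (S := fun z => sumw n (fun w => dw r (RInt f 0) w * gmob (tw r w) z)).
  replace (PRn r k (PRn r n f) x - RInt f 0 1 * PRn r k (fun _ => 1) x) with
    ((PRn r k (PRn r n f) x - PRn r k S x) +
     (PRn r k S x - RInt f 0 1 * PRn r k (fun _ => 1) x)) by ring.
  eapply Rle_trans; [apply Rabs_triang|]. apply Rplus_le_compat.
  - set (e := (/ (2 - r)) ^ n * (g 1 - g 0)).
    assert (A : forall z, in01 z -> Rabs (PRn r n f z - S z) <= e).
    { intros; apply PRn_gmob_approx; auto. }
    pose proof (PRn_one_bound r k x Hr Hx) as B.
    assert (He : 0 <= e) by (eapply Rle_trans; [apply Rabs_pos | apply (A x Hx)]).
    assert (L1 : PRn r k (PRn r n f) x <= PRn r k (fun z => 1 * S z + e * 1) x).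
    { apply PRn_le; auto. intros z Hz; specialize (A z Hz); apply Rabs_le_between in A; lra. }
    assert (L2 : PRn r k (fun z => 1 * S z + (- e) * 1) x <= PRn r k (PRn r n f) x).
    { apply PRn_le; auto. intros z Hz; specialize (A z Hz); apply Rabs_le_between in A; lra. }
    rewrite (PRn_lin r k 1 _ S (fun _ => 1)) in L1. rewrite (PRn_lin r k 1 _ S (fun _ => 1)) in L2.
    apply Rabs_le. nra.
  - unfold S. rewrite (PRn_sumw_comm r k n (fun w z => dw r (RInt f 0) w * gmob (tw r w) z)).
    assert (E : RInt f 0 1 = sumw n (dw r (RInt f 0))).
    { rewrite sumw_dw by auto. assert (Z : RInt f 0 0 = 0) by apply (RInt_point 0 f). rewrite Z, Rminus_0_r; reflexivity. }
    rewrite E, Rmult_comm, <- sumw_scal.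
    set (c := (/ (2 - r)) ^ k * (/ (1 - r)) ^ 3).
    assert (Hc : 0 < c).
    { apply Rmult_lt_0_compat; apply pow_lt; apply Rinv_0_lt_compat; lra. }
    apply Rle_trans with (sumw n (fun w => c * Rabs (dw r (RInt f 0) w))).
    2:{ rewrite sumw_scal. apply Rmult_le_compat_l; [lra|]. apply sumw_dw_RInt_abs with g; auto. }
    apply sumw_dist. intros w Hw. rewrite PRn_scal.
    replace (PRn r k (fun _ => 1) x) with (PRn r k (gmob 0) x).
    2:{ apply PRn_ext; auto. intros; unfold gmob; field; lra. }
    set (d := dw r (RInt f 0) w).
    replace (d * PRn r k (gmob (tw r w)) x - PRn r k (gmob 0) x * d) with
      ((PRn r k (gmob (tw r w)) x - PRn r k (gmob 0) x) * d) by ring.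
    rewrite Rabs_mult. apply Rmult_le_compat_r; [apply Rabs_pos|].
    eapply Rle_trans; [apply PRn_gmob_lip; auto using okt_0, okt_tw|].
    unfold c. rewrite (Rmult_assoc _ _ (Rabs _)).
    apply Rmult_le_compat_l; [left; apply pow_lt, Rinv_0_lt_compat; lra|].
    replace ((/ (1 - r)) ^ 3) with ((/ (1 - r)) ^ 2 * / (1 - r)) by (simpl; ring).
    apply Rmult_le_compat_l; [left; apply pow_lt, Rinv_0_lt_compat; lra|].
    destruct (okt_tw r w Hr) as [Ht Hb]. rewrite Rminus_0_r, Rabs_pos_eq by auto.
    apply Rmult_le_reg_l with (1 - r); [lra|]. rewrite Rinv_r; lra.
Qed.

(** * Riemann integrability of functions of bounded variation *)

Lemma IsStepFun_ext f g a b : a <= b -> (forall x, a < x < b -> f x = g x) ->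
  IsStepFun f a b -> IsStepFun g a b.
Proof.
  intros Hab Heq [l [lf (H1 & H2 & H3 & H4 & H5)]]. exists l, lf.
  repeat split; auto. intros i Hi x Hx. rewrite <- (H5 i Hi x Hx). symmetry; apply Heq.
  rewrite Rmin_left in H2 by auto. rewrite Rmax_right in H3 by auto.
  destruct (RList.RList_P6 l) as [M _]. specialize (M H1).
  pose proof (M 0%nat i ltac:(lia) ltac:(lia)).
  pose proof (M (S i) (Nat.pred (length l)) ltac:(lia) ltac:(lia)).
  unfold open_interval in Hx. lra.
Qed.

Definition step_approx (f : R -> R) (a b e : R) : Prop :=
  exists phi psi : StepFun a b,
    (forall t, a <= t <= b -> Rabs (f t - phi t) <= psi t) /\ RiemannInt_SF psi <= e.

Lemma step_approx_glue f a c b e1 e2 : a <= c <= b ->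
  step_approx f a c e1 -> step_approx f c b e2 -> step_approx f a b (e1 + e2).
Proof.
  intros Hc (phi1 & psi1 & H1 & I1) (phi2 & psi2 & H2 & I2).
  set (glue := fun (u v : R -> R) x => if Rle_dec x c then u x else v x).
  assert (L : forall u v, IsStepFun u a c -> IsStepFun (glue u v) a c).
  { intros u v; apply IsStepFun_ext; [lra|]. intros x Hx; unfold glue; destruct (Rle_dec x c); lra. }
  assert (R : forall u v, IsStepFun v c b -> IsStepFun (glue u v) c b).
  { intros u v; apply IsStepFun_ext; [lra|]. intros x Hx; unfold glue; destruct (Rle_dec x c); lra. }
  pose (p1 := L psi1 psi2 (pre psi1)). pose (p2 := R psi1 psi2 (pre psi2)).
  exists (mkStepFun (StepFun_P46 (L phi1 phi2 (pre phi1)) (R phi1 phi2 (pre phi2)))),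
    (mkStepFun (StepFun_P46 p1 p2)). split.
  - intros t Ht; simpl; unfold glue; destruct (Rle_dec t c); [apply H1|apply H2]; lra.
  - rewrite <- (StepFun_P43 p1 p2). apply Rplus_le_compat.
    + eapply Rle_trans; [|apply I1]. apply StepFun_P37; [lra|].
      intros x Hx; simpl; unfold glue; destruct (Rle_dec x c); lra.
    + eapply Rle_trans; [|apply I2]. apply StepFun_P37; [lra|].
      intros x Hx; simpl; unfold glue; destruct (Rle_dec x c); lra.
Qed.

Lemma bvdom_sub a b a' b' f g : bvdom a b f g -> a <= a' -> b' <= b -> bvdom a' b' f g.
Proof. intros H Ha Hb x y Hx Hxy Hy; apply H; lra. Qed.

(** Bisection halves the lengths, while the increments of [g] over the two halves add up to the same
    total. *)
Lemma bvdom_step_approx n f g a b : a <= b -> bvdom a b f g ->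
  step_approx f a b ((g b - g a) * (b - a) / 2 ^ n).
Proof.
  revert a b; induction n as [|n IH]; intros a b Hab H.
  - exists (mkStepFun (StepFun_P4 a b (f a))), (mkStepFun (StepFun_P4 a b (g b - g a))).
    split; [|rewrite StepFun_P18; simpl; lra].
    intros t Ht; simpl; unfold fct_cte. pose proof (H a t ltac:(lra) ltac:(lra) ltac:(lra)).
    pose proof (bvdom_mono a b f g t b H). lra.
  - set (c := (a + b) / 2). assert (Hc : a <= c <= b) by (unfold c; lra).
    replace ((g b - g a) * (b - a) / 2 ^ S n) with
      ((g c - g a) * (c - a) / 2 ^ n + (g b - g c) * (b - c) / 2 ^ n).
    2:{ unfold c; simpl. field. apply pow_nonzero; lra. }
    apply step_approx_glue with c; auto; apply IH; try lra; apply bvdom_sub with a b; auto; lra.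
Qed.

Lemma bvdom_ex_RInt f g a b : a <= b -> bvdom a b f g -> ex_RInt f a b.
Proof.
  intros Hab H. apply ex_RInt_Reals_1. intros eps.
  set (D := (g b - g a) * (b - a)).
  assert (HD : 0 <= D).
  { pose proof (bvdom_mono a b f g a b H). unfold D; apply Rmult_le_pos; lra. }
  assert (E : exists n, D / 2 ^ n < eps).
  { destruct (pow_lt_1_zero (/ 2)) with (y := eps / (D + 1)) as [N HN].
    - rewrite Rabs_pos_eq; lra.
    - apply Rdiv_lt_0_compat; [apply cond_pos|lra].
    - exists N. specialize (HN N (Nat.le_refl _)).
      rewrite Rabs_pos_eq, pow_inv in HN by (apply pow_le; lra).
      apply Rle_lt_trans with ((D + 1) * / 2 ^ N).
      + unfold Rdiv; apply Rmult_le_compat_r; [|lra].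
        left; apply Rinv_0_lt_compat, pow_lt; lra.
      + apply Rlt_le_trans with ((D + 1) * (eps / (D + 1))).
        * apply Rmult_lt_compat_l; lra.
        * right; field; lra. }
  (* [Riemann_integrable] asks for step functions as data, so they are chosen from existence
     statements. *)
  destruct (constructive_indefinite_description _ E) as [n Hn].
  destruct (constructive_indefinite_description _ (bvdom_step_approx n f g a b Hab H)) as [phi E'].
  destruct (constructive_indefinite_description _ E') as [psi [H1 H2]].
  exists phi, psi. rewrite Rmin_left, Rmax_right by auto. split; auto.
  rewrite Rabs_pos_eq; [fold D in H2; lra|].
  rewrite <- (Rmult_0_l (b - a)), <- StepFun_P18. apply StepFun_P37; auto.
  intros x Hx; simpl; unfold fct_cte. eapply Rle_trans; [apply Rabs_pos|apply (H1 x); lra].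
Qed.

(** * The invariant density and the limit for bounded variation *)

Lemma h_hh r : 0 <= r < 1 -> exists c, 0 < c /\ forall x, h r x = c * hh r x.
Proof.
  intros Hr. unfold h, hh. destruct (Req_EM_T r 0) as [E|E].
  - exists 1; split; [lra|]. intros x. rewrite E. replace (1 - 0 + 0 * x) with 1 by ring. field.
  - exists (- r / ln (1 - r)); split; [|reflexivity].
    assert (ln (1 - r) < 0) by (rewrite <- ln_1; apply ln_increasing; lra).
    replace (- r / ln (1 - r)) with (r / - ln (1 - r)) by (field; lra).
    apply Rdiv_lt_0_compat; lra.
Qed.

Lemma h_pos r x : 0 <= r < 1 -> in01 x -> 0 < h r x.
Proof.
  intros Hr Hx; destruct (h_hh r Hr) as (c & Hc & E). rewrite E.
  pose proof (hh_bound r x Hr Hx). nra.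
Qed.

Lemma h_bounded r : 0 <= r < 1 -> exists H, 0 < H /\ forall x, in01 x -> h r x <= H.
Proof.
  intros Hr; destruct (h_hh r Hr) as (c & Hc & E). exists (c * / (1 - r)). split.
  - apply Rmult_lt_0_compat; [auto|apply Rinv_0_lt_compat; lra].
  - intros x Hx; rewrite E. apply Rmult_le_compat_l; [lra|apply hh_bound; auto].
Qed.

Lemma PRn_h r n x : 0 <= r < 1 -> in01 x -> PRn r n (h r) x = h r x.
Proof.
  intros Hr Hx; destruct (h_hh r Hr) as (c & Hc & E).
  rewrite (PRn_ext r n _ (fun z => c * hh r z)) by auto.
  rewrite PRn_scal, PRn_hh, E by auto; reflexivity.
Qed.

Lemma h_bvdom r : 0 <= r < 1 -> bvdom 0 1 (h r) (fun x => - h r x).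
Proof.
  intros Hr x y Hx Hxy Hy; destruct (h_hh r Hr) as (c & Hc & E). rewrite !E.
  assert (hh r y <= hh r x).
  { unfold hh, Rdiv; rewrite !Rmult_1_l. apply Rinv_le_contravar; nra. }
  rewrite Rabs_left1; nra.
Qed.

Lemma RInt_h r : 0 <= r < 1 -> RInt (h r) 0 1 = 1.
Proof.
  intros Hr. destruct (Req_dec r 0) as [E|E].
  - rewrite (RInt_ext _ (fun _ => 1)).
    + rewrite (RInt_const 0 1 1). unfold scal; simpl; unfold mult; simpl; lra.
    + intros; unfold h; destruct (Req_EM_T r 0); lra.
  - assert (Hl : ln (1 - r) < 0) by (rewrite <- ln_1; apply ln_increasing; lra).
    apply is_RInt_unique.
    replace 1 with (minus ((fun x => - / ln (1 - r) * ln (1 - r + r * x)) 1)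
      ((fun x => - / ln (1 - r) * ln (1 - r + r * x)) 0)) at 2.
    2:{ unfold minus, plus, opp; simpl. replace (1 - r + r * 1) with 1 by ring.
        replace (1 - r + r * 0) with (1 - r) by ring. rewrite ln_1. field; lra. }
    apply (is_RInt_derive (V := R_CompleteNormedModule)
      (fun x => - / ln (1 - r) * ln (1 - r + r * x)) (h r)).
    + rewrite Rmin_left, Rmax_right by lra. intros x Hx.
      assert (0 < 1 - r + r * x) by nra.
      auto_derive; [lra|]. unfold h; destruct (Req_EM_T r 0); [lra|]. field; lra.
    + rewrite Rmin_left, Rmax_right by lra. intros x Hx.
      assert (0 < 1 - r + r * x) by nra.
      apply continuous_ext with (fun x => (- r / ln (1 - r)) * (1 / (1 - r + r * x))).
      { intros y; unfold h; destruct (Req_EM_T r 0); [lra|reflexivity]. }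
      apply (ex_derive_continuous (V := R_NormedModule)). auto_derive; lra.
Qed.

Lemma pow_small q : 0 <= q < 1 -> forall C eps, 0 < eps -> exists N, forall n, (N <= n)%nat ->
  q ^ n * C < eps.
Proof.
  intros Hq C eps He.
  destruct (pow_lt_1_zero q) with (y := eps / (Rabs C + 1)) as [N HN].
  - rewrite Rabs_pos_eq; lra.
  - apply Rdiv_lt_0_compat; [lra|]. pose proof (Rabs_pos C); lra.
  - exists N; intros n Hn; specialize (HN n Hn). pose proof (Rabs_pos C). pose proof (Rle_abs C).
    pose proof (pow_le q n ltac:(lra)). rewrite Rabs_pos_eq in HN by auto.
    apply Rle_lt_trans with (q ^ n * (Rabs C + 1)); [apply Rmult_le_compat_l; lra|].
    apply Rlt_le_trans with (eps / (Rabs C + 1) * (Rabs C + 1)).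
    + apply Rmult_lt_compat_r; lra.
    + right; field; lra.
Qed.

Lemma inv_two_minus_lt_one r : 0 <= r < 1 -> 0 <= / (2 - r) < 1.
Proof.
  intros Hr; split; [left; apply Rinv_0_lt_compat; lra|].
  rewrite <- Rinv_1; apply Rinv_lt_contravar; lra.
Qed.

(* Since [P h = h] and [h] has integral [1], letting [n] tend to infinity in
   [PRn_bv_approx] for [f = h] identifies the limit of [P^k 1]. *)
Lemma PRn_one_h r : 0 <= r < 1 -> exists C, forall k x, in01 x ->
  Rabs (h r x - PRn r k (fun _ => 1) x) <= (/ (2 - r)) ^ k * C.
Proof.
  intros Hr. destruct (h_bounded r Hr) as (H & HH & Hb).
  exists ((/ (1 - r)) ^ 3 * H). intros k x Hx.
  apply le_epsilon. intros eps He.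
  destruct (pow_small (/ (2 - r)) (inv_two_minus_lt_one r Hr)
    ((- h r 1 - - h r 0) * / (1 - r)) eps He) as [N HN].
  specialize (HN N (Nat.le_refl _)).
  assert (A := PRn_bv_approx r (h r) (fun x => - h r x) H Hr (h_bvdom r Hr)
    (bvdom_ex_RInt _ _ 0 1 ltac:(lra) (h_bvdom r Hr))).
  specialize (A ltac:(intros z Hz; rewrite Rabs_pos_eq; [apply Hb; auto|left; apply h_pos; auto])).
  specialize (A k N x Hx). rewrite PRn_h, RInt_h, Rmult_1_l in A by auto.
  eapply Rle_trans; [apply A|]. rewrite !Rmult_assoc in *. lra.
Qed.

Lemma PRn_bv_cvg r f g : 0 <= r < 1 -> bvdom 0 1 f g ->
  forall eps, 0 < eps -> exists N, forall n, (N <= n)%nat -> forall x, in01 x ->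
  Rabs (PRn r n f x - RInt f 0 1 * h r x) < eps.
Proof.
  intros Hr Hd eps He. destruct (PRn_one_h r Hr) as [C HC].
  pose proof (bvdom_ex_RInt f g 0 1 ltac:(lra) Hd) as Hi.
  set (M := Rabs (f 0) + (g 1 - g 0)).
  pose proof (PRn_bv_approx r f g M Hr Hd Hi (fun x Hx => bvdom_bound f g x Hd Hx)) as A.
  pose proof (inv_two_minus_lt_one r Hr) as Hq.
  destruct (pow_small _ Hq ((g 1 - g 0) * / (1 - r)) (eps / 3) ltac:(lra)) as [N1 H1].
  destruct (pow_small _ Hq ((/ (1 - r)) ^ 3 * M) (eps / 3) ltac:(lra)) as [N2 H2].
  destruct (pow_small _ Hq (Rabs (RInt f 0 1) * C) (eps / 3) ltac:(lra)) as [N3 H3].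
  (* [k] is fixed first, for the chain error and the error of [PRn_one_h]; the other [n - k]
     applications then make the mixture error small. *)
  set (k := (N2 + N3)%nat).
  exists (k + N1)%nat. intros n Hn x Hx. specialize (A k (n - k)%nat x Hx).
  replace (k + (n - k))%nat with n in A by lia.
  specialize (H1 (n - k)%nat ltac:(lia)). specialize (H2 k ltac:(lia)). specialize (H3 k ltac:(lia)).
  specialize (HC k x Hx).
  replace (PRn r n f x - RInt f 0 1 * h r x) with
    ((PRn r n f x - RInt f 0 1 * PRn r k (fun _ => 1) x)
     - RInt f 0 1 * (h r x - PRn r k (fun _ => 1) x)) by ring.
  eapply Rle_lt_trans; [apply Rabs_triang|]. rewrite Rabs_Ropp, Rabs_mult.
  assert (Rabs (RInt f 0 1) * Rabs (h r x - PRn r k (fun _ => 1) x) <=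
    (/ (2 - r)) ^ k * (Rabs (RInt f 0 1) * C)).
  { eapply Rle_trans; [apply Rmult_le_compat_l; [apply Rabs_pos|apply HC]|]. right; ring. }
  rewrite !Rmult_assoc in *. lra.
Qed.

(** * Variation on a set and truncation near the pole *)

Lemma variation_extend (K : R -> Prop) F x y a l : K x -> K y -> x < y ->
  strictly_increasing (a :: l) -> List.Forall (fun z => K z /\ z <= x) (a :: l) ->
  exists l', strictly_increasing (a :: l') /\ List.Forall (fun z => K z /\ z <= y) (a :: l') /\
    variation F (a :: l) + Rabs (F y - F x) <= variation F (a :: l').
Proof.
  intros Kx Ky Hxy. revert a; induction l as [|b l IH]; intros a Hi Hf.
  - inversion Hf as [|? ? [Ka Hax] _]; subst.
    destruct (Req_dec a x) as [->|N].
    + exists (y :: nil). split; [simpl; auto|]. split.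
      * repeat constructor; auto; lra.
      * simpl; lra.
    + exists (x :: y :: nil). split; [simpl; repeat split; auto; lra|]. split.
      * repeat constructor; auto; lra.
      * simpl. pose proof (Rabs_pos (F x - F a)). lra.
  - inversion Hf as [|? ? [Ka Hax] Hf']; subst.
    change (a < b /\ strictly_increasing (b :: l)) in Hi. destruct Hi as [Hab Hi].
    destruct (IH b Hi Hf') as (l' & I' & F' & V'). exists (b :: l'). split; [|split].
    + change (a < b /\ strictly_increasing (b :: l')). auto.
    + constructor; auto. split; auto; lra.
    + change (Rabs (F b - F a) + variation F (b :: l) + Rabs (F y - F x)
        <= Rabs (F b - F a) + variation F (b :: l')). lra.
Qed.

(** [V x] is the supremum of the variations over lists in [K] bounded by [x]; the empty list makes
    it defined everywhere. Extending a list by [x] and [y] gives the increment bound. *)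
Lemma variation_function (K : R -> Prop) F M :
  (forall l, strictly_increasing l -> List.Forall K l -> variation F l <= M) ->
  exists V : R -> R, (forall x y, x <= y -> V x <= V y) /\
    (forall x y, K x -> K y -> x <= y -> Rabs (F y - F x) <= V y - V x).
Proof.
  intros HM.
  set (E := fun x u => exists l, strictly_increasing l /\
    List.Forall (fun z => K z /\ z <= x) l /\ u = variation F l).
  assert (Bd : forall x, bound (E x)).
  { intros x; exists M; intros u (l & H1 & H2 & ->). apply HM; auto.
    eapply List.Forall_impl; [|apply H2]. simpl; tauto. }
  assert (Ne : forall x, exists u, E x u).
  { intros x; exists 0, nil. simpl; auto. }
  set (V := fun x => proj1_sig (completeness (E x) (Bd x) (Ne x))).
  assert (HV : forall x, is_lub (E x) (V x)).
  { intros x; unfold V; apply proj2_sig. }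
  exists V; split.
  - intros x y Hxy. apply (HV x). intros u (l & H1 & H2 & ->).
    apply (HV y). exists l; repeat split; auto.
    eapply List.Forall_impl; [|apply H2]. intros z [Kz Hz]; split; auto; lra.
  - intros x y Kx Ky Hxy. destruct (Req_dec x y) as [->|N].
    { rewrite !Rminus_diag, Rabs_R0; lra. }
    assert (V x <= V y - Rabs (F y - F x)); [|lra].
    apply (HV x). intros u (l & H1 & H2 & ->).
    assert (exists l', strictly_increasing l' /\ List.Forall (fun z => K z /\ z <= y) l' /\
      variation F l + Rabs (F y - F x) <= variation F l') as (l' & A & B & C).
    { destruct l as [|a l].
      - exists (x :: y :: nil). repeat split; simpl; try lra.
        repeat constructor; auto; lra.
      - destruct (variation_extend K F x y a l Kx Ky ltac:(lra) H1 H2) as (l' & A & B & C).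
        exists (a :: l'); auto. }
    assert (variation F l' <= V y); [|lra].
    apply (HV y). exists l'; auto.
Qed.

(** The strict inequality leaves a closed set where [v] is kept, to which [bv_away] applies. *)
Definition trunc (v : R -> ER) (b d : R) (y : R) : R :=
  if Rlt_dec (Rabs (y - b)) d then 0 else ereal (v y).

Lemma compact_away b d : compact (fun x => 0 <= x <= 1 /\ d <= Rabs (x - b)).
Proof.
  apply compact_P4 with (fun c => 0 <= c <= 1).
  - apply compact_P3.
  - intros x Hx. unfold complementary in Hx.
    destruct (Rle_dec d (Rabs (x - b))) as [L|L].
    + assert (x < 0 \/ 1 < x) as O.
      { destruct (Rlt_dec x 0); auto. destruct (Rlt_dec 1 x); auto. exfalso; apply Hx; split; lra. }
      assert (Hp : 0 < Rmax (- x) (x - 1)).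
      { destruct O; [eapply Rlt_le_trans; [|apply Rmax_l] | eapply Rlt_le_trans; [|apply Rmax_r]]; lra. }
      exists (mkposreal _ Hp). intros y Hy [Hy1 _]. unfold disc in Hy; simpl in Hy.
      apply Rabs_def2 in Hy. unfold Rmax in *; destruct (Rle_dec _ _); lra.
    + assert (Hp : 0 < d - Rabs (x - b)) by lra.
      exists (mkposreal _ Hp). intros y Hy [_ Hy2]. unfold disc in Hy; simpl in Hy.
      pose proof (Rabs_triang (y - x) (x - b)) as Q.
      replace (y - x + (x - b)) with (y - b) in Q by ring. lra.
  - intros x [H _]; auto.
Qed.

Lemma trunc_bvdom v b d : 0 < d -> bv_away b v -> exists g, bvdom 0 1 (trunc v b d) g.
Proof.
  intros Hd Hv. set (K := fun x => 0 <= x <= 1 /\ d <= Rabs (x - b)).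
  destruct (Hv K) as (_ & (M0 & HM0) & (V0 & HV0) & _).
  { apply compact_away. }
  { intros x [Hx Hb]; split; auto. intros ->. rewrite Rminus_diag, Rabs_R0 in Hb; lra. }
  destruct (variation_function K _ V0 HV0) as (V & V1 & V2).
  (* The absolute value keeps the bound nonnegative even if [K] is empty. *)
  set (M := Rabs M0).
  assert (HM : forall x, K x -> Rabs (ereal (v x)) <= M).
  { intros x Kx; eapply Rle_trans; [apply HM0; auto|apply Rle_abs]. }
  assert (M_pos : 0 <= M) by apply Rabs_pos.
  (* Each edge of the hole gets a jump [M], the largest change between a kept value and 0. One test
     is strict and the other is not because both edge points belong to the kept set. *)
  exists (fun y => V y + M * (if Rlt_dec (b - d) y then 1 else 0)
    + M * (if Rle_dec (b + d) y then 1 else 0)).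
  intros x y Hx Hxy Hy. unfold trunc.
  pose proof (V1 x y Hxy) as Vm.
  assert (C : forall z, 0 <= z <= 1 -> Rabs (z - b) < d /\ b - d < z < b + d \/
    ~ Rabs (z - b) < d /\ K z /\ (z <= b - d \/ b + d <= z)).
  { intros z Hz. destruct (Rlt_dec (Rabs (z - b)) d) as [L|L].
    - left; split; auto. apply Rabs_def2 in L; lra.
    - right; split; auto. split; [split; auto; lra|].
      unfold Rabs in L; destruct (Rcase_abs _); lra. }
  destruct (C x ltac:(lra)) as [[X1 X2]|(X1 & X2 & X3)],
           (C y ltac:(lra)) as [[Y1 Y2]|(Y1 & Y2 & Y3)];
  destruct (Rlt_dec (Rabs (x - b)) d); try tauto;
  destruct (Rlt_dec (Rabs (y - b)) d); try tauto;
  destruct (Rlt_dec (b - d) x), (Rlt_dec (b - d) y), (Rle_dec (b + d) x), (Rle_dec (b + d) y);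
  try lra;
  try (rewrite Rminus_0_l, Rabs_Ropp; pose proof (HM x X2); lra);
  try (rewrite Rminus_0_r; pose proof (HM y Y2); lra);
  try (rewrite Rminus_0_r, Rabs_R0; lra);
  try (pose proof (V2 x y X2 Y2 Hxy); lra).
Qed.

(** * Extended-valued iterates and the pole *)

Lemma PFn_fin r n v b x : 0 <= r < 1 -> in01 x -> x <> Nat.iter n (T r) b ->
  (forall z, in01 z -> z <> b -> exists y, v z = Fin y) ->
  PFn r n v x = Fin (PRn r n (fun y => ereal (v y)) x).
Proof.
  intros Hr Hx Hne Hv; revert x Hx Hne; induction n; intros x Hx Hne; simpl in *.
  { destruct (Hv x Hx Hne) as [y ->]; reflexivity. }
  unfold PF. rewrite !IHn.
  - simpl. unfold PR. f_equal. unfold w1; fold (w0 r x). ring.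
  - apply f1_in01; auto.
  - intros E; apply Hne; rewrite <- E; symmetry; apply T_f1; auto.
  - apply f0_in01; auto.
  - intros E; apply Hne; rewrite <- E; symmetry; apply T_f0; auto.
Qed.

Lemma escale_PInf c : 0 < c -> escale c PInf = PInf.
Proof. intros; simpl; destruct (Req_EM_T c 0); [lra|reflexivity]. Qed.

Lemma PFn_ge r n v f x : 0 <= r < 1 -> in01 x -> (forall z, in01 z -> ege (v z) (f z)) ->
  ege (PFn r n v x) (PRn r n f x).
Proof.
  intros Hr Hx Hv; revert x Hx; induction n; intros x Hx; simpl; auto.
  pose proof (w0_pos r x Hr Hx) as W.
  pose proof (IHn _ (f0_in01 r x Hr Hx)) as A0. pose proof (IHn _ (f1_in01 r x Hr Hx)) as A1.
  unfold PF, PR. change (w1 r x) with (w0 r x).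
  destruct (PFn r n v (f0 r x)), (PFn r n v (f1 r x));
    rewrite ?escale_PInf by auto; simpl in *; auto. nra.
Qed.

(** T^n b is one of the two preimages of T^(n+1) b, and its weight is positive, so the convention
    for 0 times infinity does not intervene. *)
Lemma PFn_orbit r n v b : 0 <= r < 1 -> in01 b -> v b = PInf ->
  PFn r n v (Nat.iter n (T r) b) = PInf.
Proof.
  intros Hr Hb Hv; induction n as [|n IH]; [auto|].
  pose proof (iter_T_in01 r n b Hr Hb) as Hy. set (y := Nat.iter n (T r) b) in *.
  change (PF r (PFn r n v) (T r y) = PInf). unfold PF. change (w1 r (T r y)) with (w0 r (T r y)).
  pose proof (w0_pos r _ Hr (T_in01 r y Hr Hy)) as W.
  destruct (T_preimage r y Hr Hy) as [E|E]; rewrite <- E, IH, escale_PInf by auto.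
  - reflexivity.
  - destruct (escale _ _); reflexivity.
Qed.

Lemma Rpower_small e eta : 0 < e -> 0 < eta -> exists d, 0 < d /\ forall x, 0 < x <= d ->
  Rpower x e <= eta.
Proof.
  intros He Ht. exists (Rpower eta (/ e)). split; [apply exp_pos|].
  intros x Hx. replace eta with (Rpower (Rpower eta (/ e)) e).
  - apply Rle_Rpower_l; lra.
  - rewrite Rpower_mult, Rinv_l, Rpower_1; lra.
Qed.

Lemma in_U_finite b alpha v : in_U b alpha v ->
  forall z, in01 z -> z <> b -> exists y, v z = Fin y.
Proof.
  intros (_ & _ & Hbv & _) z Hz Hne.
  destruct (Hbv (fun x => 0 <= x <= 1 /\ Rabs (z - b) <= Rabs (x - b))) as (H & _).
  - apply compact_away.
  - intros x [Hx H]; split; auto. intros ->. rewrite (Rminus_diag b), Rabs_R0 in H.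
    pose proof (Rabs_pos_lt (z - b) ltac:(lra)). lra.
  - apply H; split; auto; lra.
Qed.

Lemma trunc_le v b d z : enonneg (v z) -> 0 <= trunc v b d z <= ereal (v z).
Proof.
  intros H; unfold trunc; destruct (Rlt_dec _ _); destruct (v z); simpl in *; lra.
Qed.

Lemma trunc_anti v b d d' z : d <= d' -> enonneg (v z) -> trunc v b d' z <= trunc v b d z.
Proof.
  intros Hd H; unfold trunc; destruct (Rlt_dec _ d'), (Rlt_dec _ d); destruct (v z); simpl in *; lra.
Qed.

Lemma trunc_ege v b d z : enonneg (v z) -> ege (v z) (trunc v b d z).
Proof. intros H; pose proof (trunc_le v b d z H); destruct (v z); simpl in *; auto; lra. Qed.

(** Near the pole |y - b|^(-alpha) is |y - b|^(a - alpha) times |y - b|^(-a), and the first factor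
    is at most d^(a - alpha). Giving up some of the exponent buys a coefficient that vanishes with
    [d]. *)
Lemma in_U_pole_bound b alpha a v : alpha < a -> in_U b alpha v ->
  exists d0 C, 0 < d0 /\ 0 < C /\ forall d, 0 < d <= d0 -> forall y, in01 y -> y <> b ->
  ereal (v y) <= trunc v b d y + C * Rpower d (a - alpha) * pw a (Rabs (y - b)).
Proof.
  intros Ha (Hn & _ & _ & (d0 & C1 & C2 & Hd0 & HC1 & HC2 & _ & Hb)).
  exists d0, C2. split; [lra|]. split; [lra|]. intros d Hd y Hy Hne.
  pose proof (Rabs_pos_lt (y - b) ltac:(lra)) as Hp.
  assert (0 < C2 * Rpower d (a - alpha) * pw a (Rabs (y - b))).
  { apply Rmult_lt_0_compat; [apply Rmult_lt_0_compat; [lra|apply exp_pos]|apply pw_pos]. }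
  unfold trunc; destruct (Rlt_dec (Rabs (y - b)) d) as [L|L]; [|lra].
  destruct (Hb y Hy ltac:(lra)) as [_ B]. rewrite Rabs_minus_sym in B.
  rewrite Rplus_0_l. apply Rle_trans with (C2 * Rpower (Rabs (y - b)) (- alpha)).
  { destruct (v y); simpl in *; [auto|tauto]. }
  rewrite Rmult_assoc. apply Rmult_le_compat_l; [lra|].
  replace (- alpha) with ((a - alpha) + - a) by ring. rewrite Rpower_plus.
  apply Rmult_le_compat_r; [left; apply exp_pos|]. apply Rle_Rpower_l; lra.
Qed.

(** Links the cut-off integrals of [improper_integral] to the integral of [trunc], the form in which
    the limit for bounded variation produces them. *)
Lemma RInt_trunc_split v b d : 0 < d -> in01 b -> bv_away b v ->
  exists (pr1 : Riemann_integrable (fun x => ereal (v x)) 0 (Rmax 0 (b - d)))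
         (pr2 : Riemann_integrable (fun x => ereal (v x)) (Rmin 1 (b + d)) 1),
    RiemannInt pr1 + RiemannInt pr2 = RInt (trunc v b d) 0 1.
Proof.
  intros Hd Hb Hv. destruct (trunc_bvdom v b d Hd Hv) as [g Hg].
  pose proof (bvdom_ex_RInt _ _ 0 1 ltac:(lra) Hg) as Hi.
  set (p := Rmax 0 (b - d)). set (q := Rmin 1 (b + d)).
  assert (Hp : 0 <= p <= 1 /\ p <= b /\ b - d <= p /\ (p = 0 \/ p = b - d)).
  { unfold in01, p, Rmax in *; destruct (Rle_dec _ _); lra. }
  assert (Hq : 0 <= q <= 1 /\ b <= q /\ q <= b + d /\ (q = 1 \/ q = b + d)).
  { unfold in01, q, Rmin in *; destruct (Rle_dec _ _); lra. }
  assert (I1 : ex_RInt (trunc v b d) 0 p) by (apply (ex_RInt_Chasles_1 (trunc v b d) 0 p 1); auto; lra).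
  assert (I1' : ex_RInt (trunc v b d) p 1) by (apply (ex_RInt_Chasles_2 (trunc v b d) 0 p 1); auto; lra).
  assert (I2 : ex_RInt (trunc v b d) p q) by (apply (ex_RInt_Chasles_1 (trunc v b d) p q 1); auto; lra).
  assert (I3 : ex_RInt (trunc v b d) q 1) by (apply (ex_RInt_Chasles_2 (trunc v b d) p q 1); auto; lra).
  assert (E1 : forall x, Rmin 0 p < x < Rmax 0 p -> trunc v b d x = ereal (v x)).
  { rewrite Rmin_left, Rmax_right by lra. intros x Hx; unfold trunc.
    destruct (Rlt_dec _ _) as [L|L]; auto. apply Rabs_def2 in L; lra. }
  assert (E2 : forall x, Rmin p q < x < Rmax p q -> trunc v b d x = 0).
  { rewrite Rmin_left, Rmax_right by lra. intros x Hx; unfold trunc.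
    destruct (Rlt_dec _ _) as [L|L]; auto. exfalso; apply L, Rabs_def1; lra. }
  assert (E3 : forall x, Rmin q 1 < x < Rmax q 1 -> trunc v b d x = ereal (v x)).
  { rewrite Rmin_left, Rmax_right by lra. intros x Hx; unfold trunc.
    destruct (Rlt_dec _ _) as [L|L]; auto. apply Rabs_def2 in L; lra. }
  exists (ex_RInt_Reals_0 _ _ _ (ex_RInt_ext _ _ _ _ E1 I1)),
         (ex_RInt_Reals_0 _ _ _ (ex_RInt_ext _ _ _ _ E3 I3)).
  rewrite <- !RInt_Reals.
  rewrite <- (RInt_ext _ _ _ _ E1), <- (RInt_ext _ _ _ _ E3).
  pose proof (RInt_Chasles (trunc v b d) 0 p 1 I1 I1') as C1. pose proof (RInt_Chasles (trunc v b d) p q 1 I2 I3) as C2.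
  rewrite (RInt_ext _ _ _ _ E2) in C2. rewrite (RInt_const p q 0) in C2.
  unfold plus, scal in C1, C2; simpl in C1, C2. unfold mult in C2; simpl in C2.
  rewrite <- C1, <- C2. ring.
Qed.

Lemma h_lower r : 0 <= r < 1 -> exists c, 0 < c /\ forall x, in01 x -> c <= h r x.
Proof.
  intros Hr; destruct (h_hh r Hr) as (c & Hc & E). exists c; split; auto.
  intros x Hx; rewrite E. pose proof (hh_bound r x Hr Hx). nra.
Qed.

(* Evaluating [P^n] at whichever of [0] and [1] is at distance at least [1/2]
   from [T^n b] bounds the truncated integrals without computing the integral
   of the singularity. *)
Lemma RInt_trunc_bounded r alpha b v : 0 <= r < 1 -> 0 < alpha < 1 -> in01 b ->
  in_U b alpha v -> exists M, forall d, 0 < d -> RInt (trunc v b d) 0 1 <= M.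
Proof.
  intros Hr Ha Hb Hv. set (a := (1 + alpha) / 2). assert (Ha' : 0 < a < 1) by (unfold a; lra).
  destruct (in_U_pole_bound b alpha a v ltac:(unfold a; lra) Hv) as (d0 & C2 & Hd0 & HC2 & Hpb).
  destruct (PRn_pole r a b Hr Ha' Hb) as (C & th & HC & Hth & HP).
  destruct (h_lower r Hr) as (c & Hc & Hh).
  pose proof Hv as (Hn & _ & Hbv & _).
  set (J := (fun d => RInt (trunc v b d) 0 1) : R -> R).
  assert (Hdom : forall d, 0 < d -> exists g, bvdom 0 1 (trunc v b d) g)
    by (intros; apply trunc_bvdom; auto).
  set (L := C2 * Rpower d0 (a - alpha)).
  assert (HL : 0 < L) by (apply Rmult_lt_0_compat; [auto|apply exp_pos]).
  exists (Rmax 0 (J d0) + (2 + L * (C * (1 + pw a (1 / 2)))) / c). intros d Hd. fold (J d).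
  destruct (Hdom d Hd) as [g Hg]. destruct (Hdom d0 Hd0) as [g0 Hg0].
  destruct (PRn_bv_cvg r _ g Hr Hg 1 Rlt_0_1) as [N1 H1].
  destruct (PRn_bv_cvg r _ g0 Hr Hg0 1 Rlt_0_1) as [N2 H2].
  set (n := (N1 + N2)%nat). set (y := Nat.iter n (T r) b).
  assert (exists x, in01 x /\ 1 / 2 <= Rabs (x - y)) as (x & Hx & Hxy).
  { pose proof (iter_T_in01 r n b Hr Hb) as Hy; fold y in Hy. unfold in01 in *.
    destruct (Rle_dec y (1 / 2)); [exists 1 | exists 0]; (split; [lra|]);
      unfold Rabs; destruct (Rcase_abs _); lra. }
  assert (Hne : x <> y).
  { intros ->; rewrite Rminus_diag, Rabs_R0 in Hxy; lra. }
  specialize (H1 n ltac:(lia) x Hx). specialize (H2 n ltac:(lia) x Hx).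
  fold (J d) in H1. fold (J d0) in H2. apply Rabs_def2 in H1, H2.
  specialize (HP n x Hx Hne). fold y in HP.
  (* Although [n] depends on [d], comparison with the fixed radius [d0] and th^n <= 1 give a bound
     independent of both. *)
  assert (PRn r n (trunc v b d) x <= PRn r n (fun z =>
    1 * trunc v b d0 z + L * pw a (Rabs (z - b))) x) as A.
  { apply PRn_le_avoid with b; auto. intros z Hz Hzb.
    pose proof (trunc_le v b d z (Hn z Hz)). pose proof (Hpb d0 ltac:(lra) z Hz Hzb).
    unfold L; lra. }
  rewrite (PRn_lin r n 1 L (trunc v b d0) (fun z => pw a (Rabs (z - b)))) in A.
  assert (P : C * (1 + th ^ n * pw a (Rabs (x - y))) <= C * (1 + pw a (1 / 2))).
  { apply Rmult_le_compat_l; [lra|]. apply Rplus_le_compat_l.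
    pose proof (pw_anti a (1 / 2) (Rabs (x - y)) ltac:(lra) ltac:(lra)).
    pose proof (pw_pos a (Rabs (x - y))). pose proof (pow_lt th n (proj1 Hth)).
    assert (th ^ n <= 1) by (rewrite <- (pow1 n); apply pow_incr; lra). nra. }
  assert (LP : L * PRn r n (fun z => pw a (Rabs (z - b))) x <= L * (C * (1 + pw a (1 / 2))))
    by (apply Rmult_le_compat_l; lra).
  set (S := 2 + L * (C * (1 + pw a (1 / 2)))) in *.
  assert (D : (J d - J d0) * h r x <= S) by (unfold S; lra).
  specialize (Hh x Hx).
  assert (HS : 0 < S).
  { pose proof (pw_pos a (1 / 2)).
    assert (0 < L * (C * (1 + pw a (1 / 2))))
      by (apply Rmult_lt_0_compat; [lra|apply Rmult_lt_0_compat; lra]).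
    unfold S; lra. }
  assert (J d - J d0 <= S / c).
  { apply le_div_of_mul_le; auto. destruct (Rle_dec (J d - J d0) 0).
    { apply Rle_trans with (0 * c); [apply Rmult_le_compat_r|]; lra. }
    eapply Rle_trans; [apply Rmult_le_compat_l; [lra|apply Hh] | auto]. }
  pose proof (Rmax_r 0 (J d0)). lra.
Qed.

Lemma RInt_trunc_anti v b d d' : 0 < d <= d' -> bv_away b v ->
  (forall x, 0 <= x <= 1 -> enonneg (v x)) ->
  RInt (trunc v b d') 0 1 <= RInt (trunc v b d) 0 1.
Proof.
  intros Hd Hv Hn.
  destruct (trunc_bvdom v b d ltac:(lra) Hv) as [g Hg].
  destruct (trunc_bvdom v b d' ltac:(lra) Hv) as [g' Hg'].
  apply RInt_le; [lra| | |].
  - apply bvdom_ex_RInt with g'; auto; lra.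
  - apply bvdom_ex_RInt with g; auto; lra.
  - intros x Hx; apply trunc_anti; [lra|]. apply Hn; lra.
Qed.

(** The lower bound holds at every point because truncations lie below [v]. The two-sided estimate
    is uniform where th^n |x - T^n b|^(-a) <= B; compact sets, exceptional points and periodic
    orbits differ only in how [B] is found. [I] is the supremum of the truncated integrals. *)
Lemma pole_limit r alpha b v : 0 <= r < 1 -> 0 < alpha < 1 -> in01 b -> in_U b alpha v ->
  exists I, improper_integral v b I /\
  (forall eps, 0 < eps -> exists N, forall n, (N <= n)%nat -> forall x, in01 x ->
     egt (PFn r n v x) (I * h r x - eps)) /\
  (exists a th, 0 < a /\ 0 < th < 1 /\ forall B eps, 0 < eps ->
     exists N, forall n, (N <= n)%nat -> forall x, in01 x -> x <> Nat.iter n (T r) b ->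
     th ^ n * pw a (Rabs (x - Nat.iter n (T r) b)) <= B ->
     eclose (PFn r n v x) (I * h r x) eps).
Proof.
  intros Hr Ha Hb Hv. set (a := (1 + alpha) / 2). assert (Ha' : 0 < a < 1) by (unfold a; lra).
  destruct (RInt_trunc_bounded r alpha b v Hr Ha Hb Hv) as [M HM].
  pose proof Hv as (Hn & _ & Hbv & _).
  set (J := (fun d => RInt (trunc v b d) 0 1) : R -> R) in *.
  destruct (completeness (fun u => exists d, 0 < d /\ u = J d)) as [I [HI1 HI2]].
  { exists M; intros u (d & Hd & ->); apply HM; auto. }
  { exists (J 1), 1; split; [lra|auto]. }
  assert (HJ : forall d, 0 < d -> J d <= I) by (intros d Hd; apply HI1; exists d; auto).
  assert (Hsmall : forall eta, 0 < eta -> exists d0, 0 < d0 /\ forall d, 0 < d <= d0 -> I - eta < J d).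
  { intros eta He. destruct (classic (exists d0, 0 < d0 /\ I - eta < J d0)) as [(d0 & H0 & H1)|N].
    - exists d0; split; auto. intros d Hd. eapply Rlt_le_trans; [apply H1|].
      apply RInt_trunc_anti; auto.
    - exfalso. assert (I <= I - eta); [|lra]. apply HI2. intros u (d & Hd & ->).
      apply Rnot_lt_le; intros H; apply N; exists d; auto. }
  destruct (h_bounded r Hr) as (H & HH & Hh).
  assert (Hcore : forall eta, 0 < eta -> exists d0, 0 < d0 /\ forall d, 0 < d <= d0 ->
    exists N, forall n, (N <= n)%nat -> forall x, in01 x ->
    Rabs (PRn r n (trunc v b d) x - I * h r x) < eta).
  { intros eta He. destruct (Hsmall (eta / (2 * H))) as (d0 & Hd0 & HJd).
    { apply Rdiv_lt_0_compat; lra. }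
    exists d0; split; auto. intros d Hd. specialize (HJd d Hd).
    destruct (trunc_bvdom v b d ltac:(lra) Hbv) as [g Hg].
    destruct (PRn_bv_cvg r _ g Hr Hg (eta / 2) ltac:(lra)) as [N HN]. exists N.
    intros n Hn' x Hx; specialize (HN n Hn' x Hx). fold (J d) in HN.
    replace (PRn r n (trunc v b d) x - I * h r x) with
      ((PRn r n (trunc v b d) x - J d * h r x) - (I - J d) * h r x) by ring.
    eapply Rle_lt_trans; [apply Rabs_triang|]. rewrite Rabs_Ropp.
    pose proof (h_pos r x Hr Hx). specialize (Hh x Hx). specialize (HJ d ltac:(lra)).
    rewrite (Rabs_pos_eq ((I - J d) * h r x)) by nra.
    assert ((I - J d) * h r x <= eta / (2 * H) * H) by (apply Rmult_le_compat; lra).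
    replace (eta / (2 * H) * H) with (eta / 2) in * by (field; lra). lra. }
  exists I. split; [|split].
  - intros eta He. destruct (Hsmall eta He) as (d0 & Hd0 & HJd). exists d0; split; [lra|].
    intros eps Heps. destruct (RInt_trunc_split v b eps ltac:(lra) Hb Hbv) as (pr1 & pr2 & E).
    exists pr1, pr2. rewrite E. fold (J eps). specialize (HJd eps ltac:(lra)).
    specialize (HJ eps ltac:(lra)). rewrite Rabs_left1; lra.
  - intros eps He. destruct (Hcore eps He) as (d & Hd & HN). destruct (HN d ltac:(lra)) as [N HN'].
    exists N; intros n Hn' x Hx. specialize (HN' n Hn' x Hx). apply Rabs_def2 in HN'.
    assert (G : ege (PFn r n v x) (PRn r n (trunc v b d) x)).
    { apply PFn_ge; auto. intros z Hz; apply trunc_ege; auto. }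
    destruct (PFn r n v x); simpl in *; auto; lra.
  - destruct (in_U_pole_bound b alpha a v ltac:(unfold a; lra) Hv) as (d0 & C2 & Hd0 & HC2 & Hpb).
    destruct (PRn_pole r a b Hr Ha' Hb) as (C & th & HC & Hth & HP).
    exists a, th. split; [lra|]. split; auto. intros B eps He.
    destruct (Hcore (eps / 2) ltac:(lra)) as (d1 & Hd1 & HN1).
    set (Q := C2 * (C * (1 + Rabs B))).
    assert (HQ : 0 < Q).
    { pose proof (Rabs_pos B). unfold Q; repeat apply Rmult_lt_0_compat; lra. }
    (* The pole contributes at most d^(a - alpha) * Q, which this radius keeps below eps / 2. *)
    destruct (Rpower_small (a - alpha) (eps / (2 * Q))) as (d2 & Hd2 & HR).
    { unfold a; lra. }
    { apply Rdiv_lt_0_compat; lra. }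
    set (d := Rmin d0 (Rmin d1 d2)).
    assert (Hd : 0 < d /\ d <= d0 /\ d <= d1 /\ d <= d2).
    { unfold d, Rmin; repeat destruct (Rle_dec _ _); lra. }
    specialize (HR d ltac:(lra)). destruct (HN1 d ltac:(lra)) as [N HN]. exists N.
    intros n Hn' x Hx Hne HB. specialize (HN n Hn' x Hx). specialize (HP n x Hx Hne).
    rewrite (PFn_fin r n v b) by (auto; apply in_U_finite with alpha; auto). simpl.
    set (L := C2 * Rpower d (a - alpha)).
    assert (HL : 0 < L) by (apply Rmult_lt_0_compat; [auto|apply exp_pos]).
    assert (A1 : PRn r n (trunc v b d) x <= PRn r n (fun y => ereal (v y)) x).
    { apply PRn_le; auto. intros z Hz; apply trunc_le; auto. }
    assert (A2 : PRn r n (fun y => ereal (v y)) x <= PRn r n (fun z =>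
      1 * trunc v b d z + L * pw a (Rabs (z - b))) x).
    { apply PRn_le_avoid with b; auto. intros z Hz Hzb.
      pose proof (Hpb d ltac:(lra) z Hz Hzb). unfold L; lra. }
    rewrite (PRn_lin r n 1 L (trunc v b d) (fun z => pw a (Rabs (z - b)))) in A2.
    assert (LP : L * PRn r n (fun z => pw a (Rabs (z - b))) x <= eps / 2).
    { apply Rle_trans with (L * (C * (1 + Rabs B))).
      - apply Rmult_le_compat_l; [lra|]. eapply Rle_trans; [apply HP|].
        apply Rmult_le_compat_l; [lra|]. pose proof (Rle_abs B). lra.
      - replace (L * (C * (1 + Rabs B))) with (Rpower d (a - alpha) * Q) by (unfold L, Q; ring).
        apply Rle_trans with (eps / (2 * Q) * Q); [apply Rmult_le_compat_r; lra|].
        right; field; lra. }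
    apply Rabs_def2 in HN. apply Rabs_def1; lra.
Qed.

(** * Omega-limit sets and Hausdorff dimension *)

Lemma pow_Rpower_inv th e n : 0 < th -> 0 < e ->
  pw e (Rpower th (/ e) ^ n) = / th ^ n.
Proof.
  intros Ht He. unfold pw. rewrite <- !Rpower_pow by (try apply exp_pos; auto).
  rewrite !Rpower_mult, <- Rpower_Ropp. f_equal. field; lra.
Qed.

(** Each point outside the omega-limit set has a neighbourhood that the orbit misses from some time
    on; compactness makes time and distance uniform. *)
Lemma omega_avoid r b (K : R -> Prop) : compact K ->
  (forall x, K x -> ~ omega_limit r b x) ->
  exists N c, 0 < c /\ forall n x, (N <= n)%nat -> K x -> c <= Rabs (x - Nat.iter n (T r) b).
Proof.
  intros HK Hom.
  (* A single index controls both time and distance, and the strict margin makes [P k] open. It is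
     encoded as [INR k] since covers are indexed by reals. *)
  set (P := fun (k : nat) y => exists d, / INR (S k) < d /\
    forall l, (k <= l)%nat -> d <= Rabs (y - Nat.iter l (T r) b)).
  set (F := fun z y => exists k : nat, z = INR k /\ P k y).
  assert (HF : forall z, (exists y, F z y) -> exists k : nat, z = INR k).
  { intros z (y & k & -> & _); exists k; auto. }
  destruct (HK (mkfamily (fun z => exists k : nat, z = INR k) F HF)) as [D [D1 [l D2]]].
  { split.
    - intros x Hx. specialize (Hom x Hx). unfold omega_limit in Hom.
      apply not_all_ex_not in Hom. destruct Hom as [k Hk].
      unfold adherence, point_adherent in Hk. apply not_all_ex_not in Hk. destruct Hk as [V HV].
      apply imply_to_and in HV. destruct HV as [[e He] HV].
      destruct (archimed_cor1 e (cond_pos e)) as (m & Hm & Hm0).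
      set (k' := (k + m)%nat). exists (INR k'). exists k'; split; auto.
      exists e; split.
      + eapply Rle_lt_trans; [|apply Hm]. apply Rinv_le_contravar; [apply lt_0_INR; lia|].
        apply le_INR; lia.
      + intros j Hj. apply Rnot_lt_le; intros Hlt. apply HV. exists (Nat.iter j (T r) b).
        split; [apply He; unfold disc; rewrite Rabs_minus_sym; auto|].
        exists j; split; [lia|auto].
    - intros z y (k & -> & d & Hd & Hy).
      assert (Hp : 0 < (d - / INR (S k)) / 2) by lra.
      exists (mkposreal _ Hp). intros y' Hy'. unfold disc in Hy'; cbn [pos] in Hy'.
      exists k; split; auto. exists (d - (d - / INR (S k)) / 2). split; [lra|].
      intros j Hj; specialize (Hy j Hj).
      pose proof (Rabs_triang (y - y') (y' - Nat.iter j (T r) b)) as Q.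
      replace (y - y' + (y' - Nat.iter j (T r) b)) with (y - Nat.iter j (T r) b) in Q by ring.
      rewrite (Rabs_minus_sym y y') in Q. lra. }
  assert (Hl : exists N : nat, forall k, List.In (INR k) l -> (k <= N)%nat).
  { clear. induction l as [|z l [N IH]].
    - exists 0%nat; intros k [].
    - destruct (classic (exists k0, z = INR k0)) as [[k0 ->]|Hz].
      + exists (N + k0)%nat. intros k [E|E].
        * apply INR_eq in E; lia.
        * specialize (IH k E); lia.
      + exists N. intros k [E|E]; [exfalso; apply Hz; exists k; auto|auto]. }
  destruct Hl as [N HN]. exists N, (/ INR (S N)).
  split; [apply Rinv_0_lt_compat, lt_0_INR; lia|].
  intros n x Hn Hx. destruct (D1 x Hx) as [z [(k & -> & d & Hd & Hy) Dz]].
  assert (Hk : (k <= N)%nat).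
  { apply HN. apply D2. split; [exists k; auto|auto]. }
  apply Rle_trans with (/ INR (S k)).
  - apply Rinv_le_contravar; [apply lt_0_INR; lia|apply le_INR; lia].
  - specialize (Hy n ltac:(lia)). lra.
Qed.

(** For any s > 0 the balls of index at least [N] cover [E], and the sum of (2 rho^n)^s over them is
    the tail of a geometric series. *)
Lemma hausdorff_dim_limsup_balls (y : nat -> R) rho (E : R -> Prop) : 0 < rho < 1 ->
  (forall x, E x -> forall N : nat, exists n, (N <= n)%nat /\ Rabs (x - y n) < rho ^ n) ->
  hausdorff_dim E 0.
Proof.
  intros Hrho HE. split; [auto|].
  intros t Ht. apply Rnot_lt_le; intros Hpos.
  (* Nullity at exponent t / 2 already contradicts [Ht]. *)
  assert (0 < t / 2) as Hs by lra.
  assert (t <= t / 2); [|lra]. apply Ht; [lra|].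
  set (s := t / 2) in *. intros eps delta He Hde.
  set (q := Rpower rho s).
  assert (Hq : 0 < q < 1).
  { split; [apply exp_pos|]. unfold q, Rpower. apply Rlt_le_trans with (exp 0); [|rewrite exp_0; lra].
    apply exp_increasing. assert (ln rho < 0) by (rewrite <- ln_1; apply ln_increasing; lra). nra. }
  destruct (pow_small rho ltac:(lra) 2 delta Hde) as [N1 H1].
  destruct (pow_small q ltac:(lra) (Rpower 2 s * / (1 - q)) eps He) as [N2 H2].
  set (N := (N1 + N2)%nat).
  assert (Hpow : forall i, 0 < rho ^ i) by (intros; apply pow_lt; lra).
  exists (fun i => y (N + i)%nat - rho ^ (N + i)), (fun i => y (N + i)%nat + rho ^ (N + i)).
  split; [|split].
  - intros i. specialize (H1 (N + i)%nat ltac:(lia)). specialize (Hpow (N + i)%nat). lra.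
  - intros x Hx. destruct (HE x Hx N) as (n & Hn & Hxn). exists (n - N)%nat.
    replace (N + (n - N))%nat with n by lia. apply Rabs_def2 in Hxn; lra.
  - intros n.
    assert (E1 : forall i, Rpower (y (N + i)%nat + rho ^ (N + i) - (y (N + i)%nat - rho ^ (N + i))) s
      = Rpower 2 s * q ^ N * q ^ i).
    { intros i.
      replace (y (N + i)%nat + rho ^ (N + i) - (y (N + i)%nat - rho ^ (N + i)))
        with (2 * rho ^ (N + i)) by ring.
      rewrite <- Rpower_mult_distr by (auto; lra). rewrite Rmult_assoc, <- pow_add. f_equal.
      rewrite <- !Rpower_pow by lra. unfold q.
      rewrite !Rpower_mult. f_equal; ring. }
    rewrite (sum_eq _ (fun i => q ^ i * (Rpower 2 s * q ^ N))) by (intros; rewrite E1; ring).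
    rewrite <- scal_sum. rewrite tech3 by lra.
    specialize (H2 N ltac:(lia)).
    apply Rle_trans with (Rpower 2 s * q ^ N * (1 / (1 - q))).
    + apply Rmult_le_compat_l.
      { apply Rmult_le_pos; [left; apply exp_pos|apply pow_le; lra]. }
      unfold Rdiv; apply Rmult_le_compat_r; [left; apply Rinv_0_lt_compat; lra|].
      pose proof (pow_lt q (S n) (proj1 Hq)). lra.
    + left. replace (Rpower 2 s * q ^ N * (1 / (1 - q))) with (q ^ N * (Rpower 2 s * / (1 - q)))
        by (unfold Rdiv; ring). auto.
Qed.

Lemma preperiodic_iter r b m n : (forall k, Nat.iter (n + k) (T r) b = Nat.iter (n + m + k) (T r) b) ->
  forall j l, (n <= l)%nat -> Nat.iter (l + j * m) (T r) b = Nat.iter l (T r) b.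
Proof.
  intros H j; induction j as [|j IH]; intros l Hl; simpl.
  - rewrite Nat.add_0_r; auto.
  - rewrite <- (IH l Hl). specialize (H (l - n + j * m)%nat).
    replace (n + (l - n + j * m))%nat with (l + j * m)%nat in H by lia.
    replace (n + m + (l - n + j * m))%nat with (l + (m + j * m))%nat in H by lia. auto.
Qed.

(** If a late part of the orbit missed [x], the least distance over one period would be positive and
    would hold at all later times. *)
Lemma omega_limit_preperiodic r b m x : preperiodic_m r b m -> omega_limit r b x ->
  forall N, exists n, (N <= n)%nat /\ x = Nat.iter n (T r) b.
Proof.
  intros (Hm & n0 & Hp) Hx N. pose proof (preperiodic_iter r b m n0 Hp) as Hj.
  apply NNPP; intros Hno. set (n1 := (n0 + N)%nat).
  assert (Hd : forall k, exists d, 0 < d /\ forall i, (i < k)%nat ->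
    d <= Rabs (Nat.iter (n1 + i) (T r) b - x)).
  { induction k as [|k (d & Hd & IH)].
    - exists 1; split; [lra|lia].
    - assert (Hk : 0 < Rabs (Nat.iter (n1 + k) (T r) b - x)).
      { apply Rabs_pos_lt. intros E. apply Hno. exists (n1 + k)%nat. split; [lia|lra]. }
      exists (Rmin d (Rabs (Nat.iter (n1 + k) (T r) b - x))). split.
      + apply Rmin_pos; auto.
      + intros i Hi. destruct (Nat.eq_dec i k) as [->|Hne]; [apply Rmin_r|].
        eapply Rle_trans; [apply Rmin_l|apply IH; lia]. }
  destruct (Hd m) as (d & Hd0 & Hdm).
  destruct (Hx n1 (disc x (mkposreal d Hd0))) as (y & Hy & l & Hl & ->).
  { exists (mkposreal d Hd0). intros z Hz; auto. }
  unfold disc in Hy; simpl in Hy.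
  pose proof (Nat.div_mod (l - n1) m ltac:(lia)) as Q.
  pose proof (Nat.mod_upper_bound (l - n1) m ltac:(lia)) as Q'.
  specialize (Hdm _ Q'). rewrite <- (Hj ((l - n1) / m)%nat) in Hdm by lia.
  replace (n1 + (l - n1) mod m + (l - n1) / m * m)%nat with l in Hdm by lia. lra.
Qed.

Theorem theorem3p1 (r alpha beta : R) (v : R -> ER)
  (Hr : 0 <= r < 1) (Halpha : 0 < alpha < 1) (Hbeta : 0 <= beta <= 1)
  (Hv : in_U beta alpha v) :
  exists I : R, improper_integral v beta I /\
  (* uniform convergence on compact subsets of [0,1] \ Omega_r(beta) *)
  (forall K : R -> Prop, compact K ->
     (forall x, K x -> 0 <= x <= 1 /\ ~ omega_limit r beta x) ->
     forall eps, eps > 0 -> exists N : nat, forall n : nat, (N <= n)%nat ->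
       forall x, K x -> eclose (PFn r n v x) (I * h r x) eps) /\
  (* pointwise convergence off a set of Hausdorff dimension 0 *)
  (exists E : R -> Prop, (forall x, E x -> 0 <= x <= 1) /\ hausdorff_dim E 0 /\
     forall x, 0 <= x <= 1 -> ~ E x ->
       forall eps, eps > 0 -> exists N : nat, forall n : nat, (N <= n)%nat ->
         eclose (PFn r n v x) (I * h r x) eps) /\
  (* pre-periodic, period length > 1: liminf = I h_r(x), limsup = +oo on Omega *)
  (forall p : nat, period_length r beta p -> (p > 1)%nat ->
     forall x, omega_limit r beta x ->
       (forall eps, eps > 0 ->
          (exists N : nat, forall n : nat, (N <= n)%nat -> egt (PFn r n v x) (I * h r x - eps)) /\
          (forall N : nat, exists n : nat, (N <= n)%nat /\ elt (PFn r n v x) (I * h r x + eps))) /\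
       (forall M : R, forall N : nat, exists n : nat, (N <= n)%nat /\ ege (PFn r n v x) M)) /\
  (* pre-periodic, period length 1: limit +oo on Omega *)
  (period_length r beta 1 ->
     forall x, omega_limit r beta x ->
       forall M : R, exists N : nat, forall n : nat, (N <= n)%nat -> ege (PFn r n v x) M).
Proof.
  assert (Hinf : v beta = PInf) by (destruct Hv as (_ & _ & _ & d & C1 & C2 & H); apply H).
  destruct (pole_limit r alpha beta v Hr Halpha Hbeta Hv)
    as (I & HI & Hlow & a & th & Ha & Hth & Hcvg).
  exists I. split; [auto|]. split; [|split; [|split]].
  - intros K HK HKo eps He.
    destruct (omega_avoid r beta K HK ltac:(intros x Hx; apply HKo; auto)) as (N1 & c & Hc & Hd).
    destruct (Hcvg (pw a c) eps He) as [N2 HN]. exists (N1 + N2)%nat. intros n Hn x Hx.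
    specialize (Hd n x ltac:(lia) Hx). apply HN; [lia|apply HKo; auto| |].
    + intros E. rewrite <- E, Rminus_diag, Rabs_R0 in Hd. lra.
    + pose proof (pw_anti a c _ ltac:(lra) (conj Hc Hd)).
      pose proof (pw_pos a (Rabs (x - Nat.iter n (T r) beta))). pose proof (pow_lt th n (proj1 Hth)).
      assert (th ^ n <= 1) by (rewrite <- (pow1 n); apply pow_incr; lra). nra.
  (* Then (rho^n)^(-a) = th^(-n), so outside the ball of radius rho^n the bound holds with [B] equal
     to 1. *)
  - set (rho := Rpower th (/ a)).
    assert (Hrho : 0 < rho < 1).
    { split; [apply exp_pos|]. unfold rho, Rpower.
      apply Rlt_le_trans with (exp 0); [|rewrite exp_0; lra]. apply exp_increasing.
      assert (ln th < 0) by (rewrite <- ln_1; apply ln_increasing; lra).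
      assert (0 < / a) by (apply Rinv_0_lt_compat; lra). nra. }
    exists (fun x => 0 <= x <= 1 /\
      forall N : nat, exists n, (N <= n)%nat /\ Rabs (x - Nat.iter n (T r) beta) < rho ^ n).
    split; [tauto|]. split.
    + apply hausdorff_dim_limsup_balls with (fun n => Nat.iter n (T r) beta) rho; auto. tauto.
    + intros x Hx HE eps He.
      destruct (Hcvg 1 eps He) as [N2 HN].
      assert (exists N1 : nat, forall n, (N1 <= n)%nat -> rho ^ n <= Rabs (x - Nat.iter n (T r) beta))
        as [N1 HN1].
      { apply NNPP; intros Hno. apply HE. split; auto. intros N. apply NNPP; intros Hno'.
        apply Hno. exists N. intros n Hn. apply Rnot_lt_le; intros L. apply Hno'. exists n; auto. }
      exists (N1 + N2)%nat. intros n Hn. specialize (HN1 n ltac:(lia)).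
      pose proof (pow_lt rho n (proj1 Hrho)) as Hp.
      apply HN; [lia|auto| |].
      * intros E. rewrite <- E, Rminus_diag, Rabs_R0 in HN1. lra.
      * pose proof (pw_anti a _ _ ltac:(lra) (conj Hp HN1)) as A.
        unfold rho in A. rewrite pow_Rpower_inv in A by lra.
        pose proof (pow_lt th n (proj1 Hth)).
        apply Rle_trans with (th ^ n * / th ^ n); [apply Rmult_le_compat_l; lra|].
        right; field; lra.
  - intros p [Hp Hmin] Hp1 x Hx.
    pose proof (omega_limit_preperiodic r beta p x Hp Hx) as Hio.
    assert (Hx01 : in01 x).
    { destruct (Hio 0%nat) as (n & _ & ->). apply iter_T_in01; auto. }
    split.
    + intros eps He. split.
      { destruct (Hlow eps He) as [N HN]. exists N; intros; apply HN; auto. }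
      intros N. destruct Hp as (Hp0 & n0 & Hper).
      pose proof (preperiodic_iter r beta p n0 Hper) as Hj.
      (* Otherwise the orbit is constant from [n0] on and 1 is a period, against minimality of
         [p]. *)
      assert (exists n1, (n0 <= n1)%nat /\ Nat.iter n1 (T r) beta <> x) as (n1 & Hn1 & Hne).
      { apply NNPP; intros Hno.
        assert (HA : forall n1, (n0 <= n1)%nat -> Nat.iter n1 (T r) beta = x).
        { intros n1 Hn1. apply NNPP; intros Hne. apply Hno; exists n1; auto. }
        assert (p <= 1)%nat; [|lia]. apply Hmin. split; [lia|]. exists n0; intros k.
        rewrite !HA by lia; auto. }
      set (y := Nat.iter n1 (T r) beta) in *.
      (* At the times n1 + j p the orbit sits at [y], at a fixed distance from [x], so the iterates
         converge at [x] along this subsequence. *)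
      destruct (Hcvg (pw a (Rabs (x - y))) eps He) as [N2 HN].
      exists (n1 + (N + N2) * p)%nat.
      assert ((N + N2) <= (N + N2) * p)%nat by nia.
      split; [lia|].
      specialize (HN (n1 + (N + N2) * p)%nat ltac:(lia) x Hx01).
      rewrite Hj in HN by auto. fold y in HN. specialize (HN ltac:(auto)).
      assert (Hc : eclose (PFn r (n1 + (N + N2) * p) v x) (I * h r x) eps).
      { apply HN. pose proof (pw_pos a (Rabs (x - y))).
        assert (th ^ (n1 + (N + N2) * p) <= 1)
          by (rewrite <- (pow1 (n1 + (N + N2) * p)); apply pow_incr; lra). nra. }
      destruct (PFn r (n1 + (N + N2) * p) v x); simpl in *; auto.
      apply Rabs_def2 in Hc; lra.
    + intros M N. destruct (Hio N) as (n & Hn & ->). exists n; split; auto.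
      rewrite PFn_orbit by auto. simpl; auto.
  - intros [Hp _] x Hx M.
    pose proof (omega_limit_preperiodic r beta 1 x Hp Hx) as Hio.
    destruct Hp as (_ & n0 & Hper). destruct (Hio n0) as (n1 & Hn1 & E).
    (* With period one the orbit stays at [x] from [n1] on, so every later iterate is infinite
       there. *)
    exists n1. intros n Hn.
    pose proof (preperiodic_iter r beta 1 n0 Hper (n - n1) n1 Hn1) as Hj.
    replace (n1 + (n - n1) * 1)%nat with n in Hj by lia. rewrite E, <- Hj.
    rewrite PFn_orbit by auto. simpl; auto.
Qed.
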